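(* Let $\mathcal H$ and $\mathcal K$ be complex Hilbert spaces, let $H_0$ be a self-adjoint operator on $\mathcal H$, let $F\colon \mathcal H \to \mathcal K$ be a closed $|H_0|^{1/2}$-compact operator, and let $\lambda \in \mathbb R$. If $\lambda$ is semi-regular for $H_0$ (with respect to $F$), then $F^*F$ is a regular direction for $H_0$ at $\lambda$. That is: if there exist a bounded self-adjoint operator $J$ on $\mathcal K$ and a number $r \in \mathbb R$ such that the norm limit $T_{\lambda+i0}(H_0 + rF^*JF)$ exists, then there exists $s \in \mathbb R$ such that the norm limit $T_{\lambda+i0}(H_0 + sF^*F)$ exists.
   Context: $\mathcal H$, $\mathcal K$ are complex Hilbert spaces, $H_0$ is a (possibly unbounded) self-adjoint operator on $\mathcal H$, and $F\colon\mathcal H\to\mathcal K$ is a closed (possibly unbounded) operator which is $|H_0|^{1/2}$-compact: $\operatorname{dom}|H_0|^{1/2}\subseteq \operatorname{dom}F$ and $F(1+|H_0|)^{-1/2}$ is compact. Such an $F$ is called a rigging. $\mathcal B_{sa}(\mathcal K)$ denotes the bounded self-adjoint operators on $\mathcal K$. Resolvent: $R_z(H)=(H-z)^{-1}$. Sandwiched resolvent: for non-real $z$, $T_z(H_0)=F R_z(H_0)F^*$, understood as a bounded (in fact compact) operator on $\mathcal K$, namely the closure of $FR_z(H_0)F^*$ from $\operatorname{dom}F^*$; equivalently $T_z(H_0)=[F(1+|H_0|)^{-1/2}]\,(1+|H_0|)R_z(H_0)\,[F(1+|H_0|)^{-1/2}]^*$. Perturbed operators: for $J\in\mathcal B_{sa}(\mathcal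 K)$ and $r \in \mathbb R$, the self-adjoint operator $H_0+rF^*JF$ is understood in the standard form sense, i.e. it is the self-adjoint operator $H$ whose resolvent at non-real $z$ is $R_z(H)=R_z(H_0)-r\,(FR_{\bar z}(H_0))^*J\,[1+rT_z(H_0)J]^{-1}FR_z(H_0)$. Then $T_z(H)=FR_z(H)F^*$ (closure) is the bounded operator $[1+rT_z(H_0)J]^{-1}T_z(H_0)$. The operator $F^*F$ corresponds to $J=1$. Boundary value: for $H=H_0+rF^*JF$, $T_{\lambda+i0}(H):=\lim_{y\to0^+}T_{\lambda+iy}(H)$ in operator norm, when this limit exists. Regular direction: for $J\in\mathcal B_{sa}(\mathcal K)$, $V=F^*JF$ is a regular direction for $H_0$ at $\lambda$ if $T_{\lambda+i0}(H_0+rF^*JF)$ exists for at least one $r\in\mathbb R$. Semi-regular (= essentially regular): $\lambda\in\mathbb R$ is semi-regular for $H_0$ if there is at least one $J\in\mathcal B_{sa}(\mathcal K)$ such that $F^*JF$ is a regular direction for $H_0$ at $\lambda$. *)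

(* Defs.v *)
From HB Require Import structures.
From mathcomp Require Import all_boot all_order all_algebra.
From mathcomp Require Import all_classical all_reals all_analysis.
From mathcomp Require Import complex.

Set Implicit Arguments.
Unset Strict Implicit.
Unset Printing Implicit Defensive.
Import Order.TTheory GRing.Theory Num.Theory.
Import numFieldNormedType.Exports.
Local Open Scope classical_set_scope.
Local Open Scope ring_scope.

(* [inner] is linear in its first argument and antilinear in its second. *)
HB.mixin Record isHilbert (R : realType) V of CompleteNormedModule R[i] V := {
  inner : {dot V for (@Num.conj R[i])} ;
  innerE : forall x : V, inner x x = `|x| ^+ 2 }.

#[short(type="hilbertType")]
HB.structure Definition Hilbert (R : realType) :=
  { V of CompleteNormedModule R[i] V & isHilbert R V }.

(* Operators, bounded or not, are represented by their graphs. The operations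
   below are those of linear relations; on graphs of operators they are the
   usual ones, with the natural domains, and [A^-1]%relation is the inverse,
   an operator exactly when A is injective. *)
Section Operators.
Variable R : realType.
Implicit Types U V W : hilbertType R.

Definition graph U V (f : U -> V) : set (U * V) := [set xy | xy.2 = f xy.1].

Definition op_dom U V (A : set (U * V)) : set U := [set x | exists y, A (x, y)].

Definition is_operator U V (A : set (U * V)) : Prop :=
  [/\ A (0, 0),
      forall (a : R[i]) p q, A p -> A q -> A (a *: p + q) &
      forall x y y', A (x, y) -> A (x, y') -> y = y'].

Definition op_comp U V W (B : set (V * W)) (A : set (U * V)) : set (U * W) :=
  (B \; A)%relation.

Definition op_add U V (A B : set (U * V)) : set (U * V) :=
  [set xy | exists v w, [/\ A (xy.1, v), B (xy.1, w) & xy.2 = v + w]].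

Definition op_scale U V (a : R[i]) (A : set (U * V)) : set (U * V) :=
  [set xy | exists2 v, A (xy.1, v) & xy.2 = a *: v].

Definition adjoint U V (A : set (U * V)) : set (V * U) :=
  [set yw | forall x v, A (x, v) -> inner v yw.1 = inner x yw.2].

Definition self_adjoint U (A : set (U * U)) : Prop :=
  [/\ is_operator A, dense (op_dom A) & adjoint A = A].

Definition positive_op U (A : set (U * U)) : Prop :=
  forall x y, A (x, y) -> 0 <= inner y x.

Definition compact_op U V (A : set (U * V)) : Prop :=
  exists2 f : {linear U -> V},
    A = graph f & precompact (f @` [set x | `|x| <= 1]).

Definition bounded_self_adjoint U (J : {linear U -> U}) : Prop :=
  continuous J /\ forall x y : U, inner (J x) y = inner x (J y).

End Operators.

Notation "B <o> A" := (op_comp B A) (at level 40, left associativity).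

Section Riggings.
Variable R : realType.
Implicit Types H K : hilbertType R.

(* A positive self-adjoint operator has exactly one positive self-adjoint
   square root; in particular |A| = (A^* A)^(1/2) is well defined. Hence the
   existential quantifier over A, B and S in [rigging] only names them. *)
Definition is_sqrt H (A B : set (H * H)) : Prop :=
  [/\ self_adjoint B, positive_op B & B <o> B = A].

Definition is_modulus H (A B : set (H * H)) : Prop :=
  is_sqrt (adjoint A <o> A) B.

(* F is closed and |H0|^(1/2)-compact, where
   A = |H0|, B = |H0|^(1/2) and S = (1 + |H0|)^(-1/2). *)
Definition rigging H K (H0 : set (H * H)) (F : set (H * K)) : Prop :=
  [/\ is_operator F, closed F &
    exists A B S : set (H * H),
      [/\ is_modulus H0 A, is_sqrt A B,
          is_sqrt ((op_add (graph idfun) A)^-1)%relation S,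
          op_dom B `<=` op_dom F & compact_op (F <o> S)]].

Definition resolvent H (A : set (H * H)) (z : R[i]) : set (H * H) :=
  ((op_add A (op_scale (- z) (graph idfun)))^-1)%relation.

Definition sandwiched_resolvent H K (F : set (H * K)) (A : set (H * H))
    (z : R[i]) : set (K * K) :=
  closure (F <o> resolvent A z <o> adjoint F).

(* A is the self-adjoint operator H0 + r F^* J F. *)
Definition form_perturbation H K (H0 : set (H * H)) (F : set (H * K))
    (J : {linear K -> K}) (r : R) (A : set (H * H)) : Prop :=
  self_adjoint A /\
  forall z : R[i], complex.Im z != 0 ->
    resolvent A z =
    op_add (resolvent H0 z)
      (op_scale (- r%:C%C)
        (adjoint (F <o> resolvent H0 (Num.conj z)) <o> graph J
         <o> ((op_add (graph idfun)
                (op_scale r%:C%C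
                  (sandwiched_resolvent F H0 z <o> graph J)))^-1)%relation
         <o> (F <o> resolvent H0 z))).

(* The limit of T_(lambda + iy)(A) as y decreases to 0 exists in the operator
   norm. *)
Definition has_boundary_value H K (F : set (H * K)) (A : set (H * H))
    (lambda : R) : Prop :=
  exists2 L : {linear K -> K}, continuous L &
  forall e : R, 0 < e -> \forall y \near 0^'+,
  exists T : {linear K -> K},
    [/\ continuous T,
        sandwiched_resolvent F A (lambda +i* y)%C = graph T &
        forall x, `|T x - L x| <= e%:C%C * `|x|].

Definition regular_direction H K (H0 : set (H * H)) (F : set (H * K))
    (lambda : R) (J : {linear K -> K}) : Prop :=
  exists (r : R) (A : set (H * H)),
    form_perturbation H0 F J r A /\ has_boundary_value F A lambda.

Definition semi_regular H K (H0 : set (H * H)) (F : set (H * K))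
    (lambda : R) : Prop :=
  exists2 J : {linear K -> K},
    bounded_self_adjoint J & regular_direction H0 F lambda J.

End Riggings.

(* Main.v *)
(** Write S = (1 + |H0|)^(-1/2), G = F S and M = H0 (1 + |H0|)^(-1), which are
    bounded, G being compact. Then the resolvent of H0 at z is
    S (M - z S^2)^(-1) S and T_z(H0) = G (M - z S^2)^(-1) G^*, so that
    H0 + s F^* F is S^(-1) (M + s G^* G) S^(-1) for s > 0.

    Let H = H0 + r F^* J F with boundary value L of T_z(H), and let T' be
    T_z(H0 + s F^* F). The second resolvent identity reads
    (1 + T_z(H) (s - r J)) T' = T_z(H), so T' converges as soon as
    1 + L (s - r J) is bounded below. As L is compact this holds when
    1 + L (s - r J) is injective. If u = - L (s - r J) u and
    w = (s - r J) u, then <L w, w> = - <u, w> is real, and Im L >= 0 forces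
    <L w, w'> = <w, L w'> for any two such w, w'; hence null vectors for distinct
    real s are orthogonal, and compactness of L leaves only finitely many
    exceptional s in ]0, 1]. *)

From HB Require Import structures.
Require Import Defs.
From mathcomp Require Import all_boot all_order all_algebra.
From mathcomp Require Import all_classical all_reals all_analysis.
From mathcomp Require Import complex.
From mathcomp Require Import ring lra finmap.

Set Implicit Arguments.
Unset Strict Implicit.
Unset Printing Implicit Defensive.
Import Order.TTheory GRing.Theory Num.Theory.
Import numFieldNormedType.Exports.
Local Open Scope classical_set_scope.
Local Open Scope ring_scope.

(** * Norms and inner products *)

(** No spectral calculus for H0 is used, and no commutation of S with H0 is ever established. The
    modulus enters through |H0|^2 = H0^2 alone: it gives |H0 x| and | |H0| x | the same norm, so H0
    S^2 and (1 + |H0|) (H0 - z)^(-1) are bounded because |H0| S^2 and H0 (H0 - z)^(-1) are. What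
    remains is to conjugate these two operators by S although S^(-1) is unbounded; a theorem of Lax
    on operators symmetric for the form <S^2 x, y> does this and yields M and X.

    The Fredholm alternative is bypassed as well. For an injective 1 + compact, compactness gives a
    lower bound, and surjectivity is inherited from a nearby surjective operator: a coercive one for
    1 + s T_z(H0), and 1 + T_z(H) (s - r J), which has the explicit right inverse 1 - T' (s - r J),
    for its limit 1 + L (s - r J).

    The defining formula of H yields (1 + r T_z(H0) J) T_z(H) = T_z(H0), whereas the comparison with
    T' needs the factors in the other order; that version is the adjoint of the same identity at the
    conjugate of z. *)

Section RealNorm.
Variable R : realType.
Implicit Types (a b : R[i]) (r : R).
Local Notation Re := (@complex.Re R).
Local Notation Im := (@complex.Im R).

Lemma cReD a b : Re (a + b) = Re a + Re b. Proof. by case: a; case: b. Qed.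
Lemma cImD a b : Im (a + b) = Im a + Im b. Proof. by case: a; case: b. Qed.
Lemma cReN a : Re (- a) = - Re a. Proof. by case: a. Qed.
Lemma cImN a : Im (- a) = - Im a. Proof. by case: a. Qed.
Lemma cReM a b : Re (a * b) = Re a * Re b - Im a * Im b.
Proof. by case: a; case: b. Qed.
Lemma cImM a b : Im (a * b) = Re a * Im b + Im a * Re b.
Proof. by case: a; case: b. Qed.
Lemma conjCE a : Num.conj a = conjc a.
Proof. by []. Qed.
Lemma cReJ a : Re (Num.conj a) = Re a.
Proof. by rewrite conjCE; case: a. Qed.
Lemma cImJ a : Im (Num.conj a) = - Im a.
Proof. by rewrite conjCE; case: a. Qed.
Lemma conjR r : Num.conj (r%:C)%C = (r%:C)%C.
Proof. by rewrite conjCE conjc_real. Qed.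
Lemma Re_real r : Re (r%:C)%C = r. Proof. by []. Qed.
Lemma complexP a b : Re a = Re b -> Im a = Im b -> a = b.
Proof. by case: a; case: b => a1 b1 a2 b2 /= -> ->. Qed.

Lemma complex_gt0 a : 0 < a -> 0 < Re a /\ a = ((Re a)%:C)%C.
Proof.
by rewrite ltcE /= => /andP[/eqP i0 ->]; split=> //; exact: complexP.
Qed.

(* The norm of a [hilbertType] takes its values in R[i]; [rn] is the same norm
   with values in R, where [lra] and [nra] apply. *)
Definition rn (V : normedZmodType R[i]) (x : V) : R := Re `|x|.

Section NormedZmod.
Variable V : normedZmodType R[i].
Implicit Types x y : V.

Lemma rnE x : `|x| = ((rn x)%:C)%C.
Proof. by apply: complexP => //=; rewrite (ger0_Im (normr_ge0 x)). Qed.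

Lemma rn_ge0 x : 0 <= rn x.
Proof. by rewrite -lecR -rnE normr_ge0. Qed.

Lemma rn0 : rn (0 : V) = 0. Proof. by rewrite /rn normr0. Qed.

Lemma rn_eq0 x : (rn x == 0) = (x == 0).
Proof. by rewrite -(normr_eq0 x) rnE -(inj_eq (@complexI R)). Qed.

Lemma rn0_eq x : rn x = 0 -> x = 0.
Proof. by move=> /eqP; rewrite rn_eq0 => /eqP. Qed.

Lemma rn_gt0 x : (0 < rn x) = (x != 0).
Proof. by rewrite lt_def rn_eq0 rn_ge0 andbT. Qed.

Lemma rnD x y : rn (x + y) <= rn x + rn y.
Proof. by rewrite -lecR -rnE rmorphD /= -!rnE ler_normD. Qed.

Lemma rnN x : rn (- x) = rn x. Proof. by rewrite /rn normrN. Qed.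

Lemma rnC x y : rn (x - y) = rn (y - x). Proof. by rewrite -opprB rnN. Qed.

Lemma rnB x y : rn (x - y) <= rn x + rn y.
Proof. by rewrite -(rnN y) rnD. Qed.

Lemma rnBB x y z : rn (x - z) <= rn (x - y) + rn (y - z).
Proof. by apply: le_trans (rnD _ _); rewrite addrA subrK. Qed.

Lemma rn_leB x y : rn x <= rn (x - y) + rn y.
Proof. by rewrite -{1}[x](subrK y) rnD. Qed.

End NormedZmod.

Lemma rnM a b : rn (a * b) = rn a * rn b.
Proof. by apply: (@complexI R); rewrite rmorphM /= -!rnE normrM. Qed.

Lemma rn_real r : rn ((r%:C)%C : R[i]) = `|r|.
Proof. by rewrite /rn normc_def /= expr0n /= addr0 sqrtr_sqr. Qed.

Lemma rn_nat n : rn (n%:R : R[i]) = n%:R.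
Proof. by rewrite -(rmorph_nat (@real_complex_def R (Phant R))) rn_real normr_nat. Qed.

Lemma rn_conj a : rn (Num.conj a) = rn a.
Proof. by rewrite /rn conjCE normcJ. Qed.

Lemma rnI_ge a : `|Im a| <= rn a.
Proof.
rewrite -lecR -rnE; have := normc_ge_Re ('i%C * a).
by rewrite cReM /= mul0r mul1r sub0r normrN normrM normc_def /= expr0n /= add0r expr1n sqrtr1 mul1r.
Qed.

Lemma rnZ (V : normedModType R[i]) a (x : V) : rn (a *: x) = rn a * rn x.
Proof. by apply: (@complexI R); rewrite rmorphM /= -!rnE normrZ. Qed.

End RealNorm.

Section InnerProduct.
Variables (R : realType) (U : hilbertType R).
Implicit Types (x y z : U) (a : R[i]).
Local Notation Re := (@complex.Re R).
Local Notation Im := (@complex.Im R).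

Lemma ipDl x y z : inner (x + y) z = inner x z + inner y z.
Proof. exact: linearDl. Qed.
Lemma ipDr x y z : inner z (x + y) = inner z x + inner z y.
Proof. exact: linearDr. Qed.
Lemma ipNl x z : inner (- x) z = - inner x z.
Proof. exact: linearNl. Qed.
Lemma ipNr x z : inner z (- x) = - inner z x.
Proof. exact: linearNr. Qed.
Lemma ipBl x y z : inner (x - y) z = inner x z - inner y z.
Proof. by rewrite ipDl ipNl. Qed.
Lemma ipBr x y z : inner z (x - y) = inner z x - inner z y.
Proof. by rewrite ipDr ipNr. Qed.
Lemma ipZl a x z : inner (a *: x) z = a * inner x z.
Proof. exact: linearZl_LR. Qed.
Lemma ipZr a x z : inner z (a *: x) = Num.conj a * inner z x.
Proof. exact: linearZr_LR. Qed.
Lemma ip0l z : inner 0 z = 0. Proof. exact: linear0l. Qed.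
Lemma ip0r z : inner z 0 = 0. Proof. exact: linear0r. Qed.
Lemma ipC x y : inner x y = Num.conj (inner y x).
Proof. by rewrite (@hermC _ _ _ _ (@inner R U) x y) expr0 mul1r. Qed.

Definition ipE := (ipDl, ipDr, ipNl, ipNr, ipZl, ipZr, ip0l, ip0r).

Lemma ipxx x : inner x x = ((rn x ^+ 2)%:C)%C.
Proof. by rewrite innerE rnE -rmorphXn. Qed.

Lemma Re_ipxx x : Re (inner x x) = rn x ^+ 2. Proof. by rewrite ipxx. Qed.
Lemma Im_ipxx x : Im (inner x x) = 0. Proof. by rewrite ipxx. Qed.

Lemma ReC x y : Re (inner x y) = Re (inner y x).
Proof. by rewrite ipC cReJ. Qed.
Lemma ImC x y : Im (inner x y) = - Im (inner y x).
Proof. by rewrite ipC cImJ. Qed.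

Lemma ip_eq0 x : inner x x = 0 -> x = 0.
Proof.
by rewrite ipxx => /complexI/eqP; rewrite sqrf_eq0 => /eqP; exact: rn0_eq.
Qed.

Lemma ip_ext x y : (forall z, inner x z = inner y z) -> x = y.
Proof. by move=> h; apply/eqP; rewrite -subr_eq0; apply/eqP/ip_eq0; rewrite ipBl h subrr. Qed.

Lemma rn_sqrD x y : rn (x + y) ^+ 2 = rn x ^+ 2 + rn y ^+ 2 + 2 * Re (inner x y).
Proof. by rewrite -!Re_ipxx ipDl !ipDr !cReD (ReC y x); ring. Qed.

Lemma rn_sqrB x y : rn (x - y) ^+ 2 = rn x ^+ 2 + rn y ^+ 2 - 2 * Re (inner x y).
Proof. by rewrite rn_sqrD rnN ipNr cReN; ring. Qed.

Lemma CauchySchwarz_Re x y : Re (inner x y) <= rn x * rn y.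
Proof.
have [->|y0] := eqVneq y 0; first by rewrite ip0r rn0 mulr0.
have y0' : 0 < rn y by rewrite rn_gt0.
(* Expanding this square gives 2 |x| |y| (|x| |y| - Re <x, y>). *)
have h := sqr_ge0 (rn (((rn y)%:C)%C *: x - ((rn x)%:C)%C *: y)).
move: h; rewrite rn_sqrB !rnZ !rn_real !ger0_norm ?rn_ge0// ipZl ipZr conjR.
rewrite !(cReM, cImM) /= !mul0r ?subr0 ?addr0 => h.
have [->|x0] := eqVneq x 0; first by rewrite ip0l rn0 mul0r.
have x0' : 0 < rn x by rewrite rn_gt0.
have h2 : 0 <= 2 * (rn x * rn y) * (rn x * rn y - Re (inner x y)) by nra.
rewrite -subr_ge0; rewrite pmulr_rge0 // in h2.
by rewrite mulr_gt0 // mulr_gt0.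
Qed.

Lemma CauchySchwarz_rn x y : rn (inner x y) <= rn x * rn y.
Proof.
have [h0|h0] := eqVneq (inner x y) 0.
  by rewrite h0 rn0 mulr_ge0 ?rn_ge0.
have p0 : 0 < rn (inner x y) by rewrite rn_gt0.
(* Multiplying x by the conjugate of <x, y> turns the inner product into the real number |<x,
   y>|^2. *)
have := CauchySchwarz_Re (Num.conj (inner x y) *: x) y.
rewrite ipZl rnZ rn_conj mulrC -normCK rnE -rmorphXn /= expr2 -mulrA.
by rewrite ler_pM2l.
Qed.

Lemma ip_sup x M : 0 <= M -> (forall z, rn (inner x z) <= M * rn z) -> rn x <= M.
Proof.
move=> M0 /(_ x); rewrite ipxx rn_real ger0_norm ?sqr_ge0// expr2.
have [->|x0] := eqVneq x 0; first by rewrite rn0.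
by rewrite ler_pM2r // rn_gt0.
Qed.

End InnerProduct.

(* Tests a linear identity between vectors against all inner products. *)
Ltac vec := apply: ip_ext => ?; rewrite ?ipE; ring.

(** * Topology, continuity and completeness through the real-valued norm *)

Section Topology.
Variable R : realType.

Lemma nbhs_rnP (V : normedModType R[i]) (x : V) (A : set V) :
  nbhs x A <-> exists2 e : R, 0 < e & forall y, rn (x - y) < e -> A y.
Proof.
split=> [/nbhs_normP[e /= e0 h]|[e e0 h]].
  have [e0r ei] := complex_gt0 e0.
  exists (complex.Re e) => // y xy; apply: h => /=.
  by rewrite ei rnE ltcR.
apply/nbhs_normP; exists ((e%:C)%C) => /=; first by rewrite ltcR.
by move=> y /=; rewrite rnE ltcR; exact: h.
Qed.

Lemma dense_rnP (V : normedModType R[i]) (D : set V) :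
  dense D <-> forall x (e : R), 0 < e -> exists2 y, D y & rn (x - y) < e.
Proof.
split=> [h x e e0|h O [x Ox] oO].
  have : nbhs x [set y | rn (x - y) < e] by apply/nbhs_rnP; exists e.
  rewrite nbhsE => -[B [oB Bx] hB].
  by have [y [/hB By Dy]] := h B (ex_intro _ x Bx) oB; exists y.
have /nbhs_rnP[e e0 hO] : nbhs x O by exact: open_nbhs_nbhs.
by have [y Dy /hO] := h x e e0; exists y.
Qed.

Lemma closure_prodP (U V : normedModType R[i]) (A : set (U * V)) x y :
  closure A (x, y) <-> forall e : R, 0 < e ->
    exists p, [/\ A p, rn (x - p.1) < e & rn (y - p.2) < e].
Proof.
split=> [h e e0|h B [[P Q] /= [/nbhs_rnP[e e0 hP] /nbhs_rnP[f f0 hQ]] PQ]].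
  have : nbhs (x, y) ([set u | rn (x - u) < e] `*` [set v | rn (y - v) < e]).
    by exists ([set u | rn (x - u) < e], [set v | rn (y - v) < e]) => //=;
      split; apply/nbhs_rnP; exists e.
  by move=> /h[p [Ap [/= h1 h2]]]; exists p.
have [p [Ap p1 p2]] := h (Num.min e f) (ltac:(by rewrite lt_min e0 f0)).
exists p; split=> //; apply: PQ; split=> /=.
  by apply: hP; apply: lt_le_trans p1 _; rewrite ge_min lexx.
by apply: hQ; apply: lt_le_trans p2 _; rewrite ge_min lexx orbT.
Qed.

Definition bounded_map (U V : normedModType R[i]) (f : U -> V) :=
  exists2 M : R, 0 <= M & forall x, rn (f x) <= M * rn x.

Lemma continuous_boundedP (U V : normedModType R[i]) (f : {linear U -> V}) :
  continuous f <-> bounded_map f.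
Proof.
split=> [cf|[M M0 hM] x].
  have /nbhs_rnP[e e0 he] : nbhs (0 : U) [set x | rn (f x) < 1].
    have h1 : nbhs (f 0) [set y | rn y < 1].
      by apply/nbhs_rnP; exists 1 => // y; rewrite linear0 sub0r rnN.
    exact: (cf 0 _ h1).
  have e20 : 0 < e / 2 by rewrite divr_gt0.
  exists (2 / e); first by rewrite divr_ge0 // ltW.
  move=> x; have [->|x0] := eqVneq x 0; first by rewrite linear0 !rn0 mulr0.
  have x0' : 0 < rn x by rewrite rn_gt0.
  have c0 : 0 <= e / 2 / rn x by rewrite divr_ge0 // ltW.
  have := he (((e / 2 / rn x)%:C)%C *: x); rewrite sub0r rnN rnZ rn_real ger0_norm//.
  rewrite divfK ?gt_eqF//= => /(_ ltac:(lra)).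
  rewrite linearZ rnZ rn_real ger0_norm // => /ltW.
  rewrite mulrC mulrA ler_pdivrMr // mul1r => h.
  by rewrite mulrC mulrA ler_pdivlMr //; lra.
move=> A /nbhs_rnP[e e0 hA]; apply/nbhs_rnP.
exists (e / (M + 1)); first by rewrite divr_gt0 //; lra.
move=> y xy; apply: hA; rewrite -linearB.
apply: le_lt_trans (hM _) _; apply: le_lt_trans (_ : (M + 1) * rn (x - y) < _).
  by rewrite ler_wpM2r ?rn_ge0 //; lra.
by rewrite mulrC -ltr_pdivlMr //; lra.
Qed.

Lemma complete_filter (U : hilbertType R) (F : set_system U) : ProperFilter F ->
  (forall e : R, 0 < e -> exists x, F [set y | rn (x - y) < e]) ->
  exists l, forall e : R, 0 < e -> F [set y | rn (l - y) < e].
Proof.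
move=> PF h; have cF : cauchy F.
  apply/cauchyP => e e0.
  have [e0r ei] := complex_gt0 e0.
  have [x Fx] := h _ e0r; exists x; apply: filterS Fx => y /= xy.
  by rewrite -ball_normE /= ei rnE ltcR.
have Fl : F --> lim F := cauchy_cvg F cF.
exists (lim F) => e e0; apply: Fl; apply/nbhs_rnP; by exists e.
Qed.

Lemma complete_seq (U : hilbertType R) (u : nat -> U) :
  (forall e : R, 0 < e -> exists N, forall i j, (N <= i)%N -> (N <= j)%N ->
    rn (u i - u j) < e) ->
  exists l, forall e : R, 0 < e -> exists N, forall i, (N <= i)%N -> rn (u i - l) < e.
Proof.
move=> h; have [|l hl] := @complete_filter U (u @ \oo) _.
  move=> e e0; have [N hN] := h e e0; exists (u N).
  by exists N => // i /= Ni; apply: hN.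
exists l => e e0; have [N _ hN] := hl e e0.
by exists N => i Ni; rewrite rnC; exact: hN.
Qed.

Lemma inv_lt (e : R) : 0 < e ->
  exists N, forall i, (N <= i)%N -> i.+1%:R^-1 < e :> R.
Proof.
move=> e0; have [N _ h] := near_infty_natSinv_lt (PosNum e0).
by exists N => i; exact: h.
Qed.

End Topology.

Lemma mk_linear (K : pzRingType) (U V : lmodType K) (f : U -> V) :
  linear f -> exists g : {linear U -> V}, g =1 f.
Proof.
move=> lf; pose h := GRing.isLinear.Build _ _ _ _ f lf.
pose g : {linear U -> V} := HB.pack f h.
by exists g.
Qed.

(** * Density, Riesz representation and adjoints *)

Section Projection.
Variables (R : realType) (U : hilbertType R).
Implicit Types (N : set U) (x y : U).

Definition linear_subspace N := N 0 /\ forall (a : R[i]) x y, N x -> N y -> N (a *: x + y).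

Lemma subspaceZ N a x : linear_subspace N -> N x -> N (a *: x).
Proof. by move=> [N0 h] Nx; rewrite -[a *: x]addr0; exact: h. Qed.

Lemma subspaceD N x y : linear_subspace N -> N x -> N y -> N (x + y).
Proof. by move=> [N0 h] Nx Ny; rewrite -[x]scale1r; exact: h. Qed.

(** Projection onto the closure of N: a minimizing sequence for the distance from k to N is Cauchy,
    and if l is its limit then k - l is orthogonal to N, hence zero. Since N need not be closed, l
    itself may lie outside N. *)
Lemma subspace_dense N : linear_subspace N ->
  (forall y, (forall x, N x -> inner x y = 0) -> y = 0) ->
  forall k (e : R), 0 < e -> exists2 x, N x & rn (k - x) < e.
Proof.
move=> sN perp k.
pose E := [set rn (k - x) ^+ 2 | x in N].
have E0 : E !=set0 by exists (rn (k - 0) ^+ 2), 0 => //; case: sN.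
have lbE : has_lbound E by exists 0 => _ [x _ <-]; exact: sqr_ge0.
have infE : has_inf E by [].
set D := inf E.
have DN x : N x -> D <= rn (k - x) ^+ 2.
  by move=> Nx; apply: ge_inf => //; exists x.
have D0 : 0 <= D by apply: lb_le_inf => // _ [x _ <-]; exact: sqr_ge0.
have /choice[u hu] : forall j : nat, exists x, N x /\ rn (k - x) ^+ 2 < D + j.+1%:R^-1.
  move=> j; have [_ [x Nx <-] h] := @inf_adherent _ E j.+1%:R^-1 (ltac:(by rewrite invr_gt0)) infE.
  by exists x.
have half_sum i j : rn (u i - u j) ^+ 2 <= 2 * i.+1%:R^-1 + 2 * j.+1%:R^-1.
  have [[Ni hi] [Nj hj]] := (hu i, hu j).
  (* The midpoint of u i and u j is in N, so its distance to k is bounded below; the parallelogram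
     law then bounds |u i - u j|. *)
  have h2 := DN _ (subspaceZ (2^-1 : R[i]) sN (subspaceD sN Ni Nj)).
  have e1 : u i - u j = (k - u j) - (k - u i) by rewrite opprB [RHS]addrC addrA subrK.
  have e2 : (k - u j) + (k - u i) = (2 : R[i]) *: (k - 2^-1 *: (u i + u j)).
    rewrite scalerBr scalerA mulfV ?pnatr_eq0 // scale1r scaler_nat mulr2n.
    by rewrite addrACA -opprD (addrC (u j)).
  have := rn_sqrD (k - u j) (k - u i); have := rn_sqrB (k - u j) (k - u i).
  rewrite e2 -e1 rnZ rn_nat => -> h4; move: hi hj; move: i.+1%:R^-1 j.+1%:R^-1 => p q; lra.
have [|l hl] := @complete_seq _ _ u.
  move=> e e0; have [M hM] := @inv_lt R (e ^+ 2 / 4) (ltac:(by rewrite divr_gt0 // exprn_gt0)).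
  exists M => i j /hM hi /hM hj; have := half_sum i j.
  rewrite -(ltr_pXn2r (n := 2)) ?nnegrE ?rn_ge0 ?(ltW e0) //.
  by move: hi hj; move: i.+1%:R^-1 j.+1%:R^-1 => p q; lra.
pose d := Num.sqrt D.
have d0 : 0 <= d by exact: sqrtr_ge0.
have dD : d ^+ 2 = D by rewrite sqr_sqrtr.
have near_l (r : R) : 0 < r -> exists j, rn (u j - l) < r /\ rn (k - u j) <= d + r.
  move=> r0; have [M1 h1] := hl _ r0.
  have [M2 h2] := @inv_lt R (r ^+ 2) (ltac:(by rewrite exprn_gt0)).
  exists (maxn M1 M2); split; first by apply: h1; rewrite leq_maxl.
  rewrite -(ler_pXn2r (n := 2)) ?nnegrE ?rn_ge0 //; last by rewrite addr_ge0 // ltW.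
  have [_ h3] := hu (maxn M1 M2); have := h2 (maxn M1 M2) (leq_maxr _ _).
  by move: h3; move: (maxn M1 M2).+1%:R^-1 => p; rewrite -dD; nra.
have dN x : N x -> d <= rn (k - x).
  move=> /DN h; rewrite -(ler_pXn2r (n := 2)) ?nnegrE ?rn_ge0 //.
  by rewrite dD.
have wd : rn (k - l) <= d.
  apply/ler_addgt0Pr => r r0; have [j [h1 h2]] := near_l (r / 2) (ltac:(lra)).
  by have := rnBB k (u j) l; lra.
have wN x : N x -> d <= rn (k - l - x).
  move=> Nx; apply/ler_addgt0Pr => r r0; have [j [h1 h2]] := near_l r r0.
  have := dN _ (subspaceD sN (hu j).1 Nx); have := rnBB (k - x) l (u j).
  by rewrite opprD addrA (addrAC k (- x)) [rn (l - _)]rnC (addrAC k (- x)); lra.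
have w0 : k - l = 0.
  apply: perp => n Nn; rewrite ipC; apply/eqP; rewrite conjCE conjc_eq0 -rn_eq0.
  set w := k - l in wd wN *; set c := inner w n.
  (* Comparing k - l with k - l - t c n, the gain 2 t |c|^2 beats the loss t^2 |n|^2 |c|^2 as soon
     as t |n|^2 <= 1; the summand 1 covers n = 0. *)
  pose t : R := (rn n ^+ 2 + 1)^-1.
  have p0 : 0 < rn n ^+ 2 + 1 by have := sqr_ge0 (rn n); lra.
  have t0 : 0 < t by rewrite invr_gt0.
  have tn : t * rn n ^+ 2 <= 1 by rewrite mulrC ler_pdivrMr //; lra.
  have h1 := wN _ (subspaceZ ((t%:C)%C * c) sN Nn).
  have h2 : rn w ^+ 2 <= rn (w - ((t%:C)%C * c) *: n) ^+ 2.
    by rewrite ler_pXn2r ?nnegrE ?rn_ge0 // (le_trans wd).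
  move: h2; rewrite (rn_sqrB w (_ *: n)) rnZ ipZr rnM rn_real (ger0_norm (ltW t0)) rmorphM /= -/c.
  rewrite -(mulrA (Num.conj _)) [Num.conj c * c]mulrC -normCK rnE conjR -rmorphXn -rmorphM /=.
  have := sqr_ge0 (rn c) => h2 h3.
  have : rn c ^+ 2 <= 0.
    have h4 : 0 <= t * (t * rn n ^+ 2 * rn c ^+ 2 - 2 * rn c ^+ 2) by lra.
    by rewrite pmulr_rge0 // in h4; nra.
  by move=> h5; rewrite -sqrf_eq0 eq_le h5 h2.
move=> e e0; have [M hM] := hl _ e0; exists (u M); first by have [] := hu M.
by move/eqP: w0; rewrite subr_eq0 => /eqP ->; rewrite rnC; exact: hM.
Qed.

(** Either some nonzero w is orthogonal to the kernel of phi, and a multiple of w represents phi, or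
    the kernel is dense by [subspace_dense] and phi vanishes by continuity. *)
Lemma riesz (phi : U -> R[i]) (M : R) : 0 <= M ->
  (forall a x y, phi (a *: x + y) = a * phi x + phi y) ->
  (forall x, rn (phi x) <= M * rn x) -> exists y, forall x, phi x = inner x y.
Proof.
move=> M0 lphi bphi.
have phi0 : phi 0 = 0.
  apply: rn0_eq; apply/eqP.
  by rewrite eq_le rn_ge0 andbT (le_trans (bphi _)) // rn0 mulr0.
pose N := [set x | phi x = 0].
have sN : linear_subspace N by split=> // a x y; rewrite /N /= lphi => -> ->; rewrite mulr0 addr0.
have [[w w0 wN]|h] := pselect (exists2 w, w != 0 & forall x, N x -> inner x w = 0).
  have pw : phi w != 0.
    by apply: contra w0 => /eqP /wN /ip_eq0 ->.
  have ww : inner w w != 0 by apply: contra w0 => /eqP/ip_eq0 ->.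
  exists (Num.conj (phi w / inner w w) *: w) => x; rewrite ipZr.
  have : N (- (phi x / phi w) *: w + x) by rewrite /N /= lphi mulNr divfK // addNr.
  move=> /wN; rewrite ipDl ipZl => /eqP; rewrite addrC mulNr subr_eq0 => /eqP ->.
  by rewrite conjCK; field; rewrite pw ww.
have dN : forall k (e : R), 0 < e -> exists2 x, N x & rn (k - x) < e.
  apply: subspace_dense => // y hy; apply: contrapT => /eqP y0.
  by apply: h; exists y.
exists 0 => x; rewrite ip0r; apply: rn0_eq; apply/eqP; rewrite eq_le rn_ge0 andbT.
apply/ler_addgt0Pr => r r0; rewrite add0r.
have [n Nn hn] := dN x (r / (M + 1)) (ltac:(by rewrite divr_gt0 //; lra)).
have : phi x = phi (x - n).
  by rewrite addrC -scaleN1r lphi Nn mulr0 add0r.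
move=> ->; apply: le_trans (bphi _) _.
move: hn; rewrite ltr_pdivlMr; last by lra.
by have := rn_ge0 (x - n); nra.
Qed.

End Projection.

Section Operators.
Variable R : realType.
Implicit Types U V W : hilbertType R.

Lemma ip_extr U (x y : U) : (forall z, inner z x = inner z y) -> x = y.
Proof. by move=> h; apply: ip_ext => z; rewrite ipC h -ipC. Qed.

Lemma bounded_adjoint U V (f : {linear U -> V}) : bounded_map f ->
  exists2 g : {linear V -> U}, bounded_map g & forall x y, inner (f x) y = inner x (g y).
Proof.
move=> [M M0 hM].
have /choice[g hg] : forall y, exists z, forall x, inner (f x) y = inner x z.
  move=> y; apply: (@riesz _ _ (fun x => inner (f x) y) (M * rn y)).
  - by rewrite mulr_ge0 ?rn_ge0.
  - by move=> a x z; rewrite linearP ipDl ipZl.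
  - move=> x; apply: le_trans (CauchySchwarz_rn _ _) _; rewrite -mulrA (mulrC (rn y)) mulrA.
    by rewrite ler_wpM2r ?rn_ge0.
have lg : linear g.
  by move=> a x y; apply: ip_extr => z; rewrite -hg !ipE -!hg.
have [g' hg'] := mk_linear lg; exists g'; last by move=> x y; rewrite hg'.
exists M => // y; rewrite hg'; have My : 0 <= M * rn y by rewrite mulr_ge0 ?rn_ge0.
apply: (ip_sup My) => z.
rewrite ipC rn_conj -hg; apply: le_trans (CauchySchwarz_rn _ _) _.
have := hM z; have := rn_ge0 y; nra.
Qed.

Definition linear_rel U V (D : set (U * V)) :=
  D (0, 0) /\ forall (a : R[i]) p q, D p -> D q -> D (a *: p + q).

(** The last conclusion puts the graph of X in the closure of D; a closed relation containing D,
    possibly after a change of variables, therefore also holds along X. *)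
Lemma extension_by_density U V (D : set (U * V)) (M : R) : 0 <= M -> linear_rel D ->
  (forall x (e : R), 0 < e -> exists2 p, D p & rn (x - p.1) < e) ->
  (forall p, D p -> rn p.2 <= M * rn p.1) ->
  exists X : {linear U -> V}, [/\ forall x, rn (X x) <= M * rn x,
    forall x y, D (x, y) -> X x = y &
    forall x (e : R), 0 < e ->
      exists p, [/\ D p, rn (x - p.1) < e & rn (X x - p.2) < e]].
Proof.
move=> M0 [D0 lD] dD bD.
have subD p q : D p -> D q -> D (p - q).
  by move=> Dp Dq; rewrite addrC -scaleN1r; exact: lD.
pose Cl x y := forall e : R, 0 < e -> exists p, [/\ D p, rn (x - p.1) < e & rn (y - p.2) < e].
have bCl x y : Cl x y -> rn y <= M * rn x.
  move=> h; apply/ler_addgt0Pr => r r0.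
  have [p [Dp h1 h2]] := h (r / (M + 2)) (ltac:(by rewrite divr_gt0 //; lra)).
  have hp := bD _ Dp; have h3 := rn_leB y p.2; have h4 := rn_leB p.1 x.
  rewrite rnC in h4; move: h1 h2; rewrite !ltr_pdivlMr; [|lra|lra] => h1 h2.
  have : M * rn p.1 <= M * (rn (x - p.1) + rn x) by rewrite ler_wpM2l.
  by have := rn_ge0 (x - p.1); have := rn_ge0 (y - p.2); nra.
have lCl a x y x' y' : Cl x y -> Cl x' y' -> Cl (a *: x + x') (a *: y + y').
  move=> h h' e e0; pose r := e / (rn a + 2).
  have a0 := rn_ge0 a.
  have r0 : 0 < r by rewrite divr_gt0 //; lra.
  have [[p [Dp h1 h2]] [q [Dq h3 h4]]] := (h r r0, h' r r0).
  have er : r * (rn a + 2) = e by rewrite divfK // gt_eqF //; lra.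
  have key (W : hilbertType R) (v v' w w' : W) : rn (v - w) < r -> rn (v' - w') < r ->
      rn (a *: v + v' - (a *: w + w')) < e.
    move=> k1 k2; rewrite opprD addrACA -scalerBr.
    by have := rnD (a *: (v - w)) (v' - w'); rewrite rnZ; nra.
  by exists (a *: p + q); split; [exact: lD | exact: key | exact: key].
have /choice[X hX] : forall x, exists y, Cl x y.
  move=> x.
  have /choice[u hu] : forall j : nat, exists p, D p /\ rn (x - p.1) < j.+1%:R^-1.
    by move=> j; have [p] := dD x j.+1%:R^-1 (ltac:(by rewrite invr_gt0)); exists p.
  have [|y hy] := @complete_seq _ _ (fun j => (u j).2).
    move=> e e0; have [N hN] := @inv_lt R (e / (2 * (M + 1))) (ltac:(by rewrite divr_gt0 //; lra)).
    exists N => i j /hN hi /hN hj; have [[Di h1] [Dj h2]] := (hu i, hu j).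
    have := bD _ (subD _ _ Di Dj) => /=.
    have := rnBB (u i).1 x (u j).1; rewrite [rn (_ - x)]rnC => h3.
    have := rn_ge0 ((u i).1 - (u j).1).
    move: (lt_trans h1 hi) (lt_trans h2 hj); rewrite !ltr_pdivlMr; [|lra|lra].
    by nra.
  exists y => e e0; have [N1 h1] := @inv_lt R _ e0; have [N2 h2] := hy e e0.
  have [Dp hp] := hu (maxn N1 N2); exists (u (maxn N1 N2)); split=> //.
    by apply: lt_trans hp _; apply: h1; rewrite leq_maxl.
  by rewrite rnC; apply: h2; rewrite leq_maxr.
have uCl x y y' : Cl x y -> Cl x y' -> y = y'.
  move=> h h'; apply/eqP; rewrite -subr_eq0 -rn_eq0 eq_le rn_ge0 andbT.
  have /bCl := lCl (-1) _ _ _ _ h' h.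
  by rewrite !scaleN1r !addNr rn0 mulr0 addrC.
have lX : linear X by move=> a x y; apply: (uCl (a *: x + y)) => //; exact: lCl.
have [X' hX'] := mk_linear lX; exists X'; split=> [x|x y Dxy|x e e0].
- by rewrite hX'; exact: bCl.
- rewrite hX'; apply: (uCl x) => // e e0; exists (x, y); split=> //=; by rewrite subrr rn0.
- by rewrite hX'; exact: hX.
Qed.

End Operators.

(** * Compact operators and invertibility *)

Section CompactMaps.
Variable R : realType.
Implicit Types U V W : hilbertType R.

(** Total boundedness of the image of the unit ball. Finite nets are easy to push through bounded
    maps and norm limits, and they support the counting argument on orthonormal vectors. *)
Definition compact_map U V (f : U -> V) := forall e : R, 0 < e ->
  exists s : seq V, forall x, rn x <= 1 -> exists2 y, y \in s & rn (f x - y) <= e.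

Lemma precompact_compact_map U V (f : U -> V) :
  precompact (f @` [set x | `|x| <= 1]) -> compact_map f.
Proof.
rewrite precompactE compact_cover => cf e e0.
pose B (y : V) : set V := [set z | rn (y - z) < e].
have oB y : setT y -> open ((B y)°).
  by move=> _; exact: open_interior.
have [|D _ hD] := cf V setT (fun y : V => (B y)°) oB.
  move=> y _; exists y => //; apply/nbhs_rnP; exists e => //.
exists (enum_fset D) => x x1.
have /hD[y /= yD /interior_subset hy] : closure (f @` [set x | `|x| <= 1]) (f x).
  apply: subset_closure; exists x => //=.
  by rewrite rnE -(rmorph1 (@real_complex_def R (Phant R))) lecR.
by exists y => //; rewrite rnC ltW.
Qed.

Lemma compact_map_bounded U V (f : {linear U -> V}) : compact_map f -> bounded_map f.
Proof.
move=> /(_ 1 ltr01)[s hs].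
have [M0 hM] : 0 <= \sum_(y <- s) rn y + 1 /\ forall y, y \in s -> rn y <= \sum_(y <- s) rn y.
  split; first by rewrite addr_ge0 // sumr_ge0 // => y _; exact: rn_ge0.
  move=> y ys; rewrite (big_rem y) //= lerDl sumr_ge0 // => z _; exact: rn_ge0.
exists (\sum_(y <- s) rn y + 1) => // x.
have [->|x0] := eqVneq x 0; first by rewrite linear0 !rn0 mulr0.
have x0' : 0 < rn x by rewrite rn_gt0.
have [|y /hM ys h] := hs (((rn x)^-1%:C)%C *: x).
  by rewrite rnZ rn_real ger0_norm ?invr_ge0 ?rn_ge0 // mulVf // gt_eqF.
have := rn_leB (f (((rn x)^-1%:C)%C *: x)) y.
rewrite -ler_pdivrMr // linearZ rnZ rn_real ger0_norm ?invr_ge0 ?rn_ge0 // mulrC.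
by rewrite linearZ in h; lra.
Qed.

Lemma compact_map_compr U V W (f : {linear V -> W}) (g : {linear U -> V}) :
  compact_map f -> bounded_map g -> compact_map (f \o g).
Proof.
move=> cf [M M0 hM] e e0; have M1 : 0 < M + 1 by lra.
have [s hs] := cf _ (divr_gt0 e0 M1).
exists [seq ((M + 1)%:C)%C *: y | y <- s] => x x1 /=.
have [|y ys h] := hs ((((M + 1)^-1)%:C)%C *: g x).
  rewrite rnZ rn_real ger0_norm ?invr_ge0 ?(ltW M1) //.
  rewrite mulrC ler_pdivrMr // mul1r (le_trans (hM x)) //.
  by have := rn_ge0 x; nra.
exists (((M + 1)%:C)%C *: y); first by rewrite map_f.
have -> : f (g x) = ((M + 1)%:C)%C *: f ((((M + 1)^-1)%:C)%C *: g x).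
  rewrite linearZ scalerA -rmorphM /= mulfV ?gt_eqF //.
  by rewrite rmorph1 scale1r.
rewrite -scalerBr rnZ rn_real ger0_norm ?(ltW M1) // mulrC.
by rewrite -ler_pdivlMr.
Qed.

Lemma compact_map_compl U V W (g : {linear V -> W}) (f : U -> V) :
  bounded_map g -> compact_map f -> compact_map (g \o f).
Proof.
move=> [M M0 hM] cf e e0; have M1 : 0 < M + 1 by lra.
have [s hs] := cf _ (divr_gt0 e0 M1).
exists [seq g y | y <- s] => x /hs[y ys h]; exists (g y); first by rewrite map_f.
rewrite /= -linearB (le_trans (hM _)) //.
by rewrite ler_pdivlMr // in h; have := rn_ge0 (f x - y); nra.
Qed.

Lemma compact_map_limit U V (f : U -> V) :
  (forall e : R, 0 < e -> exists2 g : U -> V, compact_map g &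
    forall x, rn (g x - f x) <= e * rn x) -> compact_map f.
Proof.
move=> h e e0; have e2 : 0 < e / 2 by rewrite divr_gt0.
have [g cg hg] := h _ e2; have [s hs] := cg _ e2; exists s => x x1.
have [y ys hy] := hs x x1; exists y => //.
have h1 := hg x; rewrite rnC in h1; have := rnBB (f x) (g x) y; nra.
Qed.

Lemma compact_mapZ U V (f : {linear U -> V}) a :
  compact_map f -> compact_map (a \*: f).
Proof.
move=> cf; apply: (@compact_map_compl _ _ _ (a \*: (idfun : V -> V))) => //.
by exists (rn a); [exact: rn_ge0 | move=> x /=; rewrite rnZ].
Qed.

(** Pigeonhole principle along an ultrafilter; it plays the role of extracting subsequences. *)
Lemma ultra_finite_union (T : Type) (I : eqType) (G : set_system T) (s : seq I)
    (P : I -> set T) : UltraFilter G ->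
  (forall t, exists2 i, i \in s & P i t) -> exists2 i, i \in s & G (P i).
Proof.
move=> UG hs.
have : G (\bigcup_(i in [set` s]) P i).
  by apply: filterS filterT => t _; have [i si Pi] := hs t; exists i.
elim: s {hs} => [|a s IH]; first by rewrite bigcup0 // => /filter_not_empty.
have [Pa _|nPa hG] := in_ultra_setVsetC (P a) UG.
  by exists a => //; rewrite mem_head.
have [|i si Pi] := IH; last by exists i => //; rewrite in_cons si orbT.
apply: filterS (filterI nPa hG) => t [nPat [k /= + Pkt]].
by rewrite in_cons => /orP[/eqP ke|sk]; [case: nPat; rewrite -ke | exists k].
Qed.

(** Otherwise unit vectors u j satisfy u j + T (u j) -> 0. Along an ultrafilter T (u j) converges to
    some l by compactness, so u j tends to - l, which is both a null vector of 1 + T and of norm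
    1. *)
Lemma compact_bounded_below U (T : {linear U -> U}) : compact_map T ->
  (forall x, x + T x = 0 -> x = 0) ->
  exists2 c : R, 0 < c & forall x, c * rn x <= rn (x + T x).
Proof.
move=> cT inj; apply: contrapT => nc.
have [M M0 hM] := compact_map_bounded cT.
have /choice[u hu] : forall j : nat, exists x, rn x = 1 /\ rn (x + T x) < j.+1%:R^-1.
  move=> j; apply: contrapT => nj; apply: nc; exists j.+1%:R^-1; first by rewrite invr_gt0.
  move=> x; have [->|x0] := eqVneq x 0; first by rewrite rn0 mulr0 rn_ge0.
  have x0' : 0 < rn x by rewrite rn_gt0.
  rewrite leNgt; apply/negP => hx; apply: nj; exists (((rn x)^-1%:C)%C *: x).
  rewrite linearZ -scalerDr !rnZ rn_real ger0_norm ?invr_ge0 ?rn_ge0 //.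
  by split; [rewrite mulVf // gt_eqF | rewrite mulrC ltr_pdivrMr].
have [G [UG sG]] := ultraFilterLemma (_ : ProperFilter \oo).
have Gu (e : R) : 0 < e -> G [set j | rn (u j + T (u j)) < e].
  move=> e0; apply: sG; have [N hN] := inv_lt e0; exists N => // j /hN h.
  by apply: lt_trans h; have [] := hu j.
have [|l hl] := @complete_filter _ U ((fun j => T (u j)) @ G) _.
  move=> e e0; have [s hs] := cT _ (divr_gt0 e0 (ltr0n R 2)).
  have [|y _ hy] := @ultra_finite_union _ _ G s (fun y => [set j | rn (T (u j) - y) <= e / 2]) UG.
    by move=> j; apply: hs; rewrite (hu j).1.
  exists y; change (G [set j | rn (y - T (u j)) < e]).
  apply: filterS hy => j hj; rewrite /= rnC; apply: le_lt_trans hj _; lra.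
have Gl (e : R) : 0 < e -> G [set j | rn (l - T (u j)) < e] by exact: hl.
have near_l (e : R) : 0 < e -> exists j, rn (- l - u j) < e + e /\ rn (u j + T (u j)) < e.
  move=> e0; have [j [h1 h2]] := filter_ex (filterI (Gu _ e0) (Gl _ e0)).
  exists j; split => //; rewrite rnC opprK.
  have -> : u j + l = (u j + T (u j)) + (l - T (u j)) by vec.
  by apply: le_lt_trans (rnD _ _) _; exact: ltrD.
have l0 : - l = 0.
  apply: inj; apply: rn0_eq; apply/eqP; rewrite eq_le rn_ge0 andbT.
  apply/ler_addgt0Pr => e e0; rewrite add0r.
  have p0 : 0 < 2 * M + 3 by lra.
  have [j [h1 h2]] := near_l _ (divr_gt0 e0 p0).
  have -> : - l + T (- l) = (- l - u j) + T (- l - u j) + (u j + T (u j)).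
    by rewrite linearB; vec.
  have := rnD ((- l - u j) + T (- l - u j)) (u j + T (u j)).
  have := rnD (- l - u j) (T (- l - u j)); have := hM (- l - u j).
  set r := e / (2 * M + 3) in h1 h2.
  have er : r * (2 * M + 3) = e by rewrite divfK // gt_eqF.
  by have := rn_ge0 (- l - u j); nra.
(* With e = 1/2 the unit vector u j would be at distance less than e + e = 1 from - l = 0. *)
have [j [h1 _]] := near_l (2^-1) (ltac:(lra)).
by move: h1; rewrite l0 sub0r rnN (hu j).1; lra.
Qed.

End CompactMaps.

Section Inverses.
Variable R : realType.
Implicit Types U V W : hilbertType R.

Definition closed_rel U V (D : set (U * V)) := forall x y, (forall e : R, 0 < e ->
  exists p, [/\ D p, rn (x - p.1) < e & rn (y - p.2) < e]) -> D (x, y).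

Lemma graphE U V (f : U -> V) x y : graph f (x, y) = (y = f x).
Proof. by []. Qed.

Lemma closed_rel_graph U V (f : {linear U -> V}) : bounded_map f -> closed_rel (graph f).
Proof.
move=> [M M0 hM] x y h; rewrite /graph /=; apply/eqP; rewrite -subr_eq0 -rn_eq0 eq_le rn_ge0 andbT.
apply/ler_addgt0Pr => e e0; rewrite add0r.
have p0 : 0 < M + 1 by lra.
have [[a b] [ab /= h1 h2]] := h _ (divr_gt0 e0 p0); change (b = f a) in ab; subst b.
have := rnBB y (f a) (f x); have := hM (a - x); rewrite linearB [rn (a - x)]rnC.
set r := e / (M + 1) in h1 h2.
have er : r * (M + 1) = e by rewrite divfK // gt_eqF.
by nra.
Qed.

(** The inverse of D is bounded on the range of D, which is dense by the orthogonality hypothesis.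
    It extends by density, and closedness of D keeps the extension inside D. *)
Lemma bounded_inverse_rel U V (D : set (U * V)) (c : R) : linear_rel D -> closed_rel D ->
  0 < c -> (forall p, D p -> c * rn p.1 <= rn p.2) ->
  (forall y, (forall p, D p -> inner p.2 y = 0) -> y = 0) ->
  exists2 X : {linear V -> U}, bounded_map X & forall y, D (X y, y).
Proof.
move=> [D0 lD] cD c0 bD perp.
have dN : forall y (e : R), 0 < e -> exists2 z, [set y | exists x, D (x, y)] z & rn (y - z) < e.
  apply: subspace_dense.
    split=> [|a y z [x Dx] [x' Dx']]; first by exists 0.
    by exists (a *: x + x'); exact: (lD a (x, y) (x', z)).
  by move=> y hy; apply: perp => -[a b] Dp; apply: hy; exists a.
have c0' : 0 <= c^-1 by rewrite invr_ge0 ltW.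
have [|||X [bX _ hX]] := @extension_by_density _ _ _ [set q | D (q.2, q.1)] c^-1 c0'.
- by split=> [|a [x y] [x' y'] /= h h'] //; exact: (lD a (y, x) (y', x')).
- by move=> y e e0; have [z [x Dx] hz] := dN y e e0; exists (z, x).
- by move=> [y x] /bD /= h; rewrite mulrC ler_pdivlMr // mulrC.
exists X; first by exists c^-1.
move=> y; apply: cD => e e0; have [[b a] [/= Dp h1 h2]] := hX y e e0.
by exists (a, b).
Qed.

Lemma bounded_inverse U (B : {linear U -> U}) (c : R) : bounded_map B -> 0 < c ->
  (forall x, c * rn x <= rn (B x)) ->
  (forall y, (forall x, inner (B x) y = 0) -> y = 0) ->
  exists X : {linear U -> U}, [/\ bounded_map X, forall x, B (X x) = x & forall x, X (B x) = x].
Proof.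
move=> bB c0 hc perp.
have [||||X bX hX] := @bounded_inverse_rel _ _ (graph B) c _ _ c0.
- split=> [|a p q]; first by rewrite /graph /= linear0.
  by rewrite /graph /= linearP => -> ->.
- exact: closed_rel_graph.
- by move=> [x y]; rewrite graphE => ->.
- by move=> y hy; apply: perp => x; exact: (hy (x, B x)).
have BX y : B (X y) = y by have := hX y; rewrite /graph /=.
exists X; split=> // x.
have Binj z : B z = 0 -> z = 0.
  move=> Bz; have := hc z; rewrite Bz rn0 pmulr_rle0 // => h.
  by apply: rn0_eq; apply/eqP; rewrite eq_le h rn_ge0.
by apply/eqP; rewrite -subr_eq0; apply/eqP/Binj; rewrite linearB BX subrr.
Qed.

(** If y = B x is orthogonal to the range of B', then |y|^2 = <B x - B' x, y>. The lower bound on B'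
    gives |x| <= 4 |y| / (3 c), so |y|^2 <= |y|^2 / 3 and y = 0. *)
Lemma inverse_of_approx U (B B' : {linear U -> U}) (c : R) : bounded_map B' -> 0 < c ->
  (forall x, c * rn x <= rn (B' x)) -> (forall y, exists x, B x = y) ->
  (forall x, rn (B x - B' x) <= c / 4 * rn x) ->
  exists X : {linear U -> U}, [/\ bounded_map X, forall x, B' (X x) = x & forall x, X (B' x) = x].
Proof.
move=> bB' c0 hc sB hBB'; apply: (bounded_inverse bB' c0 hc) => y hy.
have [x xy] := sB y.
have h1 : rn y ^+ 2 <= rn (B x - B' x) * rn y.
  have := CauchySchwarz_Re (B x - B' x) y.
  by rewrite ipBl hy subr0 xy Re_ipxx.
have h2 := hBB' x; have h3 := hc x; have h4 := rn_leB (B' x) (B x).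
rewrite rnC in h4; rewrite xy in h1 h2 h4.
have h5 : rn (y - B' x) <= rn y / 3 by nra.
have h6 : rn y ^+ 2 <= rn y / 3 * rn y by apply: le_trans h1 _; rewrite ler_wpM2r ?rn_ge0.
apply: rn0_eq; apply/eqP; rewrite -sqrf_eq0 eq_le sqr_ge0 andbT.
by have := rn_ge0 y; nra.
Qed.

(* 1 + T is a norm limit of coercive, hence invertible, operators. *)
Lemma dissipative_inverse U (T : {linear U -> U}) (theta : R[i]) : compact_map T ->
  theta != 0 -> (forall x, x + T x = 0 -> x = 0) ->
  (forall x, 0 <= complex.Re (theta * inner (x + T x) x)) ->
  exists N : {linear U -> U}, [/\ bounded_map N,
    forall x, N x + T (N x) = x & forall x, N (x + T x) = x].
Proof.
move=> cT t0 inj diss.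
have [c c0 hc] := compact_bounded_below cT inj.
have [M M0 hM] := compact_map_bounded cT.
have t0' : 0 < rn theta by rewrite rn_gt0.
(* The perturbation a = e conj(theta) has norm exactly c / 4, as [inverse_of_approx] requires, and
   theta a = e |theta|^2 > 0 makes 1 + T + a coercive after rotation by theta. *)
pose e := c / 4 / rn theta.
have e0 : 0 < e by rewrite divr_gt0 // divr_gt0.
have et : e * rn theta = c / 4 by rewrite divfK // gt_eqF.
pose a := (e%:C)%C * Num.conj theta.
have ra : rn a = c / 4 by rewrite rnM rn_real rn_conj ger0_norm // ltW.
pose B' : {linear U -> U} := idfun \+ T.
pose B : {linear U -> U} := B' \+ (a \*: idfun).
have bB' : bounded_map B'.
  by exists (1 + M) => [|x]; [lra | rewrite /B' /=; have := rnD x (T x); have := hM x; lra].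
have co x : e * rn theta ^+ 2 * rn x ^+ 2 <= complex.Re (theta * inner (B x) x).
  have ea : theta * (a * ((rn x ^+ 2)%:C)%C) = ((e * rn theta ^+ 2 * rn x ^+ 2)%:C)%C.
    rewrite /a; have := normCK theta; rewrite rnE -rmorphXn => tt.
    by rewrite (rmorphM _ (e * _)) (rmorphM _ e) /= tt; ring.
  rewrite /B /B' /= ipDl mulrDr cReD ipZl ipxx ea Re_real.
  by have := diss x; lra.
have [||X [bX h1 h2]] := @inverse_of_approx _ B B' c bB' c0 hc.
- have := @bounded_inverse _ B (e * rn theta) _ _ _ _.
  case.
  + exists (1 + M + rn a) => [|x]; first by have := rn_ge0 a; lra.
    rewrite /B /B' /=; have := rnD (x + T x) (a *: x); have := rnD x (T x); have := hM x.
    by rewrite rnZ; lra.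
  + by rewrite mulr_gt0.
  + move=> x; have := CauchySchwarz_Re (theta *: B x) x; have := co x; rewrite ipZl rnZ.
    have [->|x0] := eqVneq x 0; first by rewrite rn0 !mulr0 rn_ge0.
    have x0' : 0 < rn x by rewrite rn_gt0.
    move=> k1 k2; rewrite -(ler_pM2l t0') -(ler_pM2r x0').
    by apply: le_trans k2; apply: le_trans k1; lra.
  + move=> y hy; have := co y; rewrite hy mulr0 => h.
    apply: rn0_eq; apply/eqP; rewrite -sqrf_eq0 eq_le sqr_ge0 andbT.
    have p0 : 0 < e * rn theta ^+ 2 by rewrite mulr_gt0 // exprn_gt0.
    by rewrite -(pmulr_rle0 _ p0).
  by move=> X [_ BX _] y; exists (X y).
- by move=> x; rewrite /B /= addrC addKr rnZ ra.
by exists X.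
Qed.

End Inverses.

(** * Self-adjoint relations *)

Section SelfAdjoint.
Variables (R : realType) (H : hilbertType R).
Implicit Types (A B : set (H * H)) (x y : H) (z : R[i]).

Definition symmetric_rel B :=
  forall x y x' y', B (x, y) -> B (x', y') -> inner y x' = inner x y'.

Lemma self_adjoint_symmetric B : self_adjoint B -> symmetric_rel B.
Proof. by move=> [_ _ aB] x y x' y' Bxy; rewrite -{1}aB; exact. Qed.

Lemma self_adjoint_closed B : self_adjoint B -> closed_rel B.
Proof.
move=> [_ _ aB] x y h; rewrite -aB => u v Buv /=.
apply/eqP; rewrite -subr_eq0 -rn_eq0 eq_le rn_ge0 andbT.
apply/ler_addgt0Pr => e e0; rewrite add0r.
have p0 : 0 < rn u + rn v + 1 by have := rn_ge0 u; have := rn_ge0 v; lra.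
have [[a b] [/= Bab h1 h2]] := h _ (divr_gt0 e0 p0).
have ab : inner v a = inner u b by move: Bab; rewrite -{1}aB; exact.
have -> : inner v x - inner u y = inner v (x - a) - inner u (y - b).
  by rewrite !ipBr ab; ring.
have := rnB (inner v (x - a)) (inner u (y - b)).
have := CauchySchwarz_rn v (x - a); have := CauchySchwarz_rn u (y - b).
set r := e / _ in h1 h2.
have er : r * (rn u + rn v + 1) = e by rewrite divfK // gt_eqF.
have := rn_ge0 u; have := rn_ge0 v; have := rn_ge0 (x - a); have := rn_ge0 (y - b).
by nra.
Qed.

Lemma resolventE B z k x : resolvent B z (k, x) <-> B (x, k + z *: x).
Proof.
split=> [[v [w [/= Bv [x' + +] ->]]]|h].
  by rewrite graphE /= => -> ->; rewrite scaleNr subrK.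
by exists (k + z *: x), (- z *: x); split=> //=; [exists x | rewrite scaleNr addrK].
Qed.

(** Here k = (B - z) x. As <B x, x> is real, Im <k, x> = - Im z |x|^2. *)
Lemma symmetric_lower_bound B z x k : symmetric_rel B -> B (x, k + z *: x) ->
  `|complex.Im z| * rn x <= rn k.
Proof.
move=> sB Bx; have := sB _ _ _ _ Bx Bx; rewrite !ipE => /(congr1 (@complex.Im R)).
rewrite [inner x k]ipC ipxx !(cImD, cImM, cImJ, cReJ) /= => h.
have [->|x0] := eqVneq x 0; first by rewrite rn0 mulr0 rn_ge0.
have x0' : 0 < rn x by rewrite rn_gt0.
rewrite -(ler_pM2r x0'); apply: le_trans (CauchySchwarz_rn _ _).
apply: le_trans (rnI_ge _).
have -> : complex.Im (inner k x) = - (complex.Im z * rn x ^+ 2) by lra.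
by rewrite normrN normrM (ger0_norm (sqr_ge0 _)) expr2 mulrA.
Qed.

(** B - z is closed and bounded below by |Im z|. A vector orthogonal to its range is an eigenvector
    of B for the conjugate of z, which the same lower bound excludes. *)
Lemma self_adjoint_resolvent B z : self_adjoint B -> complex.Im z != 0 ->
  exists X : {linear H -> H}, [/\ bounded_map X, resolvent B z = graph X &
    forall k, B (X k, k + z *: X k)].
Proof.
move=> saB z0; have sB := self_adjoint_symmetric saB; have cB := self_adjoint_closed saB.
have z0' : 0 < `|complex.Im z| by rewrite normr_gt0.
have [oB _ aB] := saB; have [B0 lB uB] := oB.
pose D : set (H * H) := [set p | B (p.1, p.2 + z *: p.1)].
have [|||y hy|X bX hX] := @bounded_inverse_rel _ _ _ D `|complex.Im z| _ _ z0'.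
- split=> [|a [x y] [x' y'] /= h h']; rewrite /D /=; first by rewrite scaler0 addr0.
  by have := lB a _ _ h h'; congr (B (_, _)); vec.
- move=> x y h; apply: cB => e e0; have z1 := rn_ge0 z.
  have p0 : 0 < 1 + rn z by lra.
  have [[a b] [Dab h1 h2]] := h _ (divr_gt0 e0 p0).
  exists (a, b + z *: a); split=> //=.
    by apply: lt_le_trans h1 _; rewrite ler_pdivrMr //; nra.
  rewrite opprD addrACA -scalerBr; apply: le_lt_trans (rnD _ _) _; rewrite rnZ.
  move: h1 h2 => /=; set r := e / _.
  have er : r * (1 + rn z) = e by rewrite divfK // gt_eqF.
  by nra.
- by move=> [x y] /(symmetric_lower_bound sB).
- have By : B (y, Num.conj z *: y).
    rewrite -aB => u v Buv /=; rewrite ipZr conjCK.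
    have : D (u, v - z *: u) by rewrite /D /= subrK.
    by move=> /hy /=; rewrite ipBl ipZl => /eqP; rewrite subr_eq0 => /eqP.
  have := @symmetric_lower_bound _ (Num.conj z) y 0 sB; rewrite add0r => /(_ By).
  rewrite cImJ normrN rn0 pmulr_rle0 // => h.
  by apply: rn0_eq; apply/eqP; rewrite eq_le h rn_ge0.
exists X; split=> //; apply/seteqP; split=> -[k x]; last first.
  by rewrite /graph /= => ->; apply/resolventE; exact: hX.
move=> /resolventE h; rewrite /graph /=.
have h2 := lB (-1) _ _ (hX k) h.
have h3 : B (x - X k, 0 + z *: (x - X k)).
  by move: h2; congr (B (_, _)) => /=; vec.
apply/eqP; rewrite -subr_eq0 -rn_eq0 eq_le rn_ge0 andbT.
by have := symmetric_lower_bound sB h3; rewrite rn0 pmulr_rle0.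
Qed.

(** The basic criterion: B - z and B - conj z are onto. Density of the domain is a consequence too:
    if y is orthogonal to it and y = (B - z) x, then <B x, x> = z |x|^2 is real, so x = 0. *)
Lemma symmetric_self_adjoint B z : is_operator B -> symmetric_rel B -> complex.Im z != 0 ->
  (forall h, exists x, B (x, h + z *: x)) ->
  (forall h, exists x, B (x, h + Num.conj z *: x)) -> self_adjoint B.
Proof.
move=> oB sB z0 hz hz'; have [B0 lB uB] := oB; split=> //.
  apply/dense_rnP; apply: subspace_dense.
    split=> [|a x y [u Bu] [v Bv]]; first by exists 0.
    by exists (a *: u + v); exact: (lB a (x, u) (y, v)).
  move=> y hy; have [x Bx] := hz y.
  have x0 : x = 0.
    have := sB _ _ _ _ Bx Bx; rewrite !ipE (hy x); last by exists (y + z *: x).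
    rewrite [inner y x]ipC (hy x); last by exists (y + z *: x).
    rewrite rmorph0 !add0r ipxx => /(congr1 (@complex.Im R)); rewrite !cImM cImJ /= => h.
    have : complex.Im z * rn x ^+ 2 = 0 by lra.
    by move/eqP; rewrite mulf_eq0 (negPf z0) /= sqrf_eq0 rn_eq0 => /eqP.
  by move: Bx; rewrite x0 scaler0 addr0 => /(uB _ _ _ B0).
apply/seteqP; split=> -[y w] h; last by move=> x v Bxv; exact: sB h.
(* x solves (B - z) x = (B^* - z) y, so y - x is orthogonal to the range of B - conj z, which is
   everything. *)
have [x Bx] := hz (w - z *: y).
have [u Bu] := hz' (y - x).
have : y - x = 0.
  apply: ip_eq0; have e1 := h _ _ Bu; have e2 := sB _ _ _ _ Bu Bx.
  have e3 : inner (y - x + Num.conj z *: u) (y - x) = inner u (z *: (y - x)).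
    by rewrite ipBr e1 e2 !ipE; ring.
  move: e3; rewrite ipDl ipZl ipZr => e3.
  by apply: (addIr (Num.conj z * inner u (y - x))); rewrite add0r.
move=> /eqP; rewrite subr_eq0 => /eqP yx; move: Bx; rewrite -yx.
by rewrite subrK.
Qed.

End SelfAdjoint.

(** * Transfer of bounds between H0 and its modulus, and conjugation by S *)

Section Modulus.
Variables (R : realType) (H : hilbertType R).
Implicit Types (A B : set (H * H)) (x y : H) (z : R[i]).

(* [B1 <o> B1 = B2 <o> B2] forces the norms of B1 x and B2 x to agree on the
   domain of the square, so that bounds on B1 <o> Y transfer to B2 <o> Y. *)
Lemma bounded_comp_of_sqr_eq (B1 B2 : set (H * H)) (Y : {linear H -> H}) (N : set H) (C : R) :
  self_adjoint B1 -> self_adjoint B2 -> B1 <o> B1 = B2 <o> B2 -> bounded_map Y ->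
  linear_subspace N -> (forall x (e : R), 0 < e -> exists2 k, N k & rn (x - k) < e) -> 0 <= C ->
  (forall k, N k -> exists q q', [/\ B1 (Y k, q), B1 (q, q') & rn q <= C * rn k]) ->
  exists2 Q : {linear H -> H}, bounded_map Q & forall k, B2 (Y k, Q k).
Proof.
move=> sa1 sa2 eqB [M M0 hM] [N0 lN] dN C0 hN.
have [ [z2 l2 u2] _ _] := sa2.
have sq k : N k -> exists2 q, B2 (Y k, q) & rn q <= C * rn k.
  move=> /hN[q [q' [B1q B1q' hq]]].
  have : (B1 <o> B1) (Y k, q') by exists q.
  rewrite eqB => -[w /= B2w B2q']; exists w => //.
  have e1 := self_adjoint_symmetric sa1 B1q B1q'.
  have e2 := self_adjoint_symmetric sa2 B2w B2q'.
  have : rn w ^+ 2 = rn q ^+ 2 by rewrite -!Re_ipxx e1 e2.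
  by move=> /eqP; rewrite eqrXn2 ?rn_ge0 // => /eqP ->.
pose D : set (H * H) := [set p | N p.1 /\ B2 (Y p.1, p.2)].
have [|||Q [bQ _ aQ]] := @extension_by_density _ _ _ D C C0.
- split=> [|a [k q] [k' q'] [/= Nk Bk] [/= Nk' Bk']]; first by split=> //=; rewrite linear0.
  by split=> /=; [exact: lN | rewrite linearP; exact: (l2 a _ _ Bk Bk')].
- by move=> x e e0; have [k Nk hk] := dN x e e0; have [q] := sq k Nk; exists (k, q).
- by move=> [k q] [/= Nk Bk]; have [q' Bq' hq'] := sq k Nk; rewrite (u2 _ _ _ Bk Bq').
exists Q; first by exists C.
move=> k; apply: (self_adjoint_closed sa2) => e e0.
have M1 : 0 < M + 1 by lra.
have r0 : 0 < Num.min e (e / (M + 1)) by rewrite lt_min e0 divr_gt0.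
have [[k' q'] [[/= Nk' Bk'] h1 h2]] := aQ k _ r0.
move: h1 h2; rewrite !lt_min => /andP[h1 h1'] /andP[h2 _].
exists (Y k', q'); split=> //=; rewrite -linearB (le_lt_trans (hM _)) //.
by rewrite ltr_pdivlMr // in h1'; have := rn_ge0 (k - k'); nra.
Qed.

Lemma sqr_iter_unbounded (t C : R) : 1 < t -> exists n, C < t ^+ (2 ^ n).
Proof.
move=> t1.
have bern n : 1 + n%:R * (t - 1) <= t ^+ n.
  elim: n => [|n IH]; first by rewrite mul0r addr0 expr0.
  have h : (1 + n%:R * (t - 1)) * t <= t ^+ n * t by rewrite ler_wpM2r //; lra.
  rewrite exprSr -natr1.
  by have := mulr_ge0 (ler0n R n) (sqr_ge0 (t - 1)); nra.
have t10 : 0 < t - 1 by lra.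
pose n := Num.bound `|C / (t - 1)|.
have hn : C < n%:R * (t - 1).
  rewrite -ltr_pdivrMr //.
  by apply: le_lt_trans (ler_norm _) _; exact: archi_boundP.
exists n; apply: lt_le_trans (_ : t ^+ n <= _); last first.
  by apply: ler_weXn2l; [lra | rewrite ltnW // ltn_expl].
by have := bern n; lra.
Qed.

(* Lax: P is symmetric for the form <S^2 x, y>, so that |S P x|^2 is at most
   |S x| |S P^2 x|; iterating the squaring gives the bound without assuming
   that S and P commute. *)
Lemma form_symmetric_bound (S : {linear H -> H}) (M : R) (P : H -> H) : bounded_map S ->
  (forall x y, inner (S x) y = inner x (S y)) -> 0 < M -> (forall x, rn (P x) <= M * rn x) ->
  (forall x y, inner (S (S (P x))) y = inner x (S (S (P y)))) ->
  forall x, rn (S (P x)) <= M * rn (S x).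
Proof.
move=> [K K0 hK] sS M0 bP sP x; rewrite leNgt; apply/negP => hx.
set a := rn (S x) in hx.
have sqP (P' : H -> H) :
    (forall x y, inner (S (S (P' x))) y = inner x (S (S (P' y)))) ->
    rn (S (P' x)) ^+ 2 <= rn (S (P' (P' x))) * a.
  by move=> sP'; rewrite -Re_ipxx sS -sP' sS; exact: CauchySchwarz_Re.
(* Each step replaces P, M, t by P^2, M^2, t^2, where t is a lower bound for |S P x| / |S x|. The
   norm bound K of S is paid only once, so t > M contradicts the growth of (t / M)^(2^n). *)
have iter_bound n : forall (P : H -> H) (M t : R), 0 <= M -> 0 <= t ->
    (forall x, rn (P x) <= M * rn x) ->
    (forall x y, inner (S (S (P x))) y = inner x (S (S (P y)))) ->
    t * a <= rn (S (P x)) -> 0 < a -> t ^+ (2 ^ n) * a <= K * M ^+ (2 ^ n) * rn x.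
  elim: n => [|n IH] {}P {hx}M t {}M0 t0 {}bP {}sP ht a0.
    rewrite expn0 !expr1; apply: le_trans ht _; apply: le_trans (hK _) _.
    by rewrite -mulrA ler_wpM2l.
  rewrite expnS !exprM; apply: (IH (P \o P)) => //; rewrite ?sqr_ge0 //.
  - move=> y /=; apply: le_trans (bP _) _.
    by have := bP y; nra.
  - by move=> y w /=; rewrite sP -[RHS]sP -!sS.
  - rewrite -(ler_pM2r a0); apply: le_trans (sqP _ sP).
    have : (t * a) ^+ 2 <= rn (S (P x)) ^+ 2.
      by rewrite ler_pXn2r // ?nnegrE ?rn_ge0 // mulr_ge0 // ltW.
    by rewrite /= exprMn [a ^+ 2]expr2 mulrA.
have a_gt0 : 0 < a.
  rewrite lt_def rn_ge0 andbT; apply/negP => /eqP a0.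
  have := sqP _ sP; rewrite a0 mulr0 => h.
  have : rn (S (P x)) = 0 by apply/eqP; rewrite -sqrf_eq0 eq_le h sqr_ge0.
  by move: hx; rewrite a0 mulr0 => + h0; rewrite h0 ltxx.
have Ma : 0 < M * a by rewrite mulr_gt0.
have [n hn] : exists n, K * rn x / a < (rn (S (P x)) / (M * a)) ^+ (2 ^ n).
  by apply: sqr_iter_unbounded; rewrite ltr_pdivlMr // mul1r.
have := iter_bound n P M (rn (S (P x)) / a) (ltW M0) _ bP sP _ a_gt0.
rewrite divfK ?gt_eqF // divr_ge0 ?rn_ge0 ?(ltW a_gt0) // => /(_ isT (lexx _)).
have -> : rn (S (P x)) / a = rn (S (P x)) / (M * a) * M by field; rewrite !gt_eqF.
rewrite exprMn; move: hn; rewrite ltr_pdivrMr //.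
have : 0 < M ^+ (2 ^ n) by rewrite exprn_gt0.
set m := M ^+ _; set w := (_ / _) ^+ _; move: m w => m w m0 h1 h2.
have : m * (w * a) <= m * (K * rn x) by move: h2; lra.
by rewrite ler_pM2l // leNgt h1.
Qed.

(** X is S Q S^(-1). For the form <S^2 x, y> the adjoint of Q is Q', so Q' Q is symmetric and
    [form_symmetric_bound] applies to it; then |S Q x|^2 = <S x, S Q' Q x>. The 1 added to M' M in
    the bound only makes the constant positive. *)
Lemma conjugation_bounded (S Q Q' : {linear H -> H}) : bounded_map S ->
  (forall x y, inner (S x) y = inner x (S y)) ->
  (forall x (e : R), 0 < e -> exists y, rn (x - S y) < e) ->
  bounded_map Q -> bounded_map Q' ->
  (forall x y, inner (S (S (Q x))) y = inner x (S (S (Q' y)))) ->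
  exists2 X : {linear H -> H}, bounded_map X & forall x, X (S x) = S (Q x).
Proof.
move=> bS sS dS [M M0 hM] [M' M'0 hM'] QQ'.
have bound x : rn (S (Q x)) <= (M' * M + 1) * rn (S x).
  have m0 : 0 <= M' * M by rewrite mulr_ge0.
  have h : rn (S (Q' (Q x))) <= (M' * M + 1) * rn (S x).
    apply: (@form_symmetric_bound S _ (Q' \o Q)) => //; first by lra.
    - move=> y /=; apply: le_trans (hM' _) _.
      by have := hM y; have := rn_ge0 y; nra.
    - by move=> y z /=; rewrite ipC -QQ' -ipC -[RHS]QQ' !sS.
  have : rn (S (Q x)) ^+ 2 <= rn (S x) * rn (S (Q' (Q x))).
    by rewrite -Re_ipxx -sS QQ' -sS; exact: CauchySchwarz_Re.
  have := rn_ge0 (S x); have := rn_ge0 (S (Q x)).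
  move: (rn (S (Q x))) (rn (S x)) (rn (S (Q' (Q x)))) (M' * M) m0 h => a b c m m0 h a0 b0 h2.
  by rewrite leNgt; apply/negP => h3; have := mulr_ge0 m0 b0; nra.
have m1 : 0 <= M' * M + 1 by have := mulr_ge0 M'0 M0; lra.
have [|||X [bX hX _]] := @extension_by_density _ _ _ [set p | exists x, p = (S x, S (Q x))] _ m1.
- split=> [|a _ _ [x ->] [y ->]]; first by exists 0; rewrite !linear0.
  by exists (a *: x + y); rewrite !linearP.
- by move=> x e e0; have [y hy] := dS x e e0; exists (S y, S (Q y)) => //; exists y.
- by move=> _ [x ->]; exact: bound.
exists X; first by exists (M' * M + 1).
by move=> x; apply: hX; exists x.
Qed.

End Modulus.

(** * Bounded operators modelling a rigging *)

Section BoundedMaps.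
Variable R : realType.
Implicit Types U V W : hilbertType R.

Lemma bounded_map_id U : bounded_map (idfun : U -> U).
Proof. by exists 1 => // x; rewrite mul1r. Qed.

Lemma bounded_map_comp U V W (f : V -> W) (g : U -> V) :
  bounded_map f -> bounded_map g -> bounded_map (f \o g).
Proof.
move=> [M M0 hM] [N N0 hN]; exists (M * N) => [|x]; first by rewrite mulr_ge0.
by rewrite (le_trans (hM _)) // -mulrA ler_wpM2l.
Qed.

Lemma bounded_mapD U V (f g : U -> V) :
  bounded_map f -> bounded_map g -> bounded_map (f \+ g).
Proof.
move=> [M M0 hM] [N N0 hN]; exists (M + N) => [|x /=]; first by rewrite addr_ge0.
by rewrite (le_trans (rnD _ _)) // mulrDl lerD.
Qed.

Lemma bounded_mapZ U V a (f : U -> V) : bounded_map f -> bounded_map (a \*: f).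
Proof.
move=> [M M0 hM]; exists (rn a * M) => [|x /=]; first by rewrite mulr_ge0 ?rn_ge0.
by rewrite rnZ -mulrA ler_wpM2l ?rn_ge0.
Qed.

Lemma bounded_mapB U V (f g : U -> V) :
  bounded_map f -> bounded_map g -> bounded_map (f \- g).
Proof.
move=> [M M0 hM] [N N0 hN]; exists (M + N) => [|x /=]; first by rewrite addr_ge0.
by rewrite (le_trans (rnB _ _)) // mulrDl lerD.
Qed.

(** The difference of the adjoints takes its values in the orthogonal complement of D. *)
Lemma eq_on_total V W (f g : {linear V -> W}) (D : set V) :
  bounded_map f -> bounded_map g -> (forall y, (forall x, D x -> inner x y = 0) -> y = 0) ->
  (forall x, D x -> f x = g x) -> forall y, f y = g y.
Proof.
move=> /bounded_adjoint[f' _ ff'] /bounded_adjoint[g' _ gg'] perp fg y.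
apply: ip_ext => z; rewrite ff' gg'; suff -> : f' z = g' z by [].
apply/eqP; rewrite -subr_eq0; apply/eqP.
by apply: perp => x Dx; rewrite ipBr -ff' -gg' fg // subrr.
Qed.

End BoundedMaps.

(* Here S = (1 + |H0|)^(-1/2), G = F S, M = H0 (1 + |H0|)^(-1), and
   X = (M - z S^2)^(-1) is the bounded operator (1 + |H0|) (H0 - z)^(-1). *)
Record rigging_model (R : realType) (H K : hilbertType R) (H0 : set (H * H))
    (F : set (H * K)) (S : {linear H -> H}) (G : {linear H -> K})
    (M : {linear H -> H}) : Prop := RiggingModel {
  rm_bS : bounded_map S;
  rm_symS : forall x y, inner (S x) y = inner x (S y);
  rm_injS : forall x, S x = 0 -> x = 0;
  rm_G : compact_map G;
  rm_FG : forall p, F (S p, G p);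
  rm_bM : bounded_map M;
  rm_symM : forall x y, inner (M x) y = inner x (M y);
  rm_res : forall z, complex.Im z != 0 -> exists X : {linear H -> H}, [/\ bounded_map X,
    resolvent H0 z = graph (fun k => S (X (S k))),
    forall p, M (X p) - z *: S (S (X p)) = p &
    forall p, X (M p - z *: S (S p)) = p] }.

Section Model.
Variables (R : realType) (H K : hilbertType R).

Lemma rigging_modelP (H0 : set (H * H)) (F : set (H * K)) :
  self_adjoint H0 -> rigging H0 F -> exists S G M, rigging_model H0 F S G M.
Proof.
move=> saH0 [opF _ [A [B [Sr [[saA posA eqA0] _ [saSr _ eqSr] _ [G FS cG]]]]]].
have [oH0 dH0 aH0] := saH0; rewrite aH0 in eqA0.
have [oA dA _] := saA; have [A0 lA uA] := oA; have [z0 l0 u0] := oH0.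
have [[Sr0 lSr uSr] _ _] := saSr.
(* Compactness of F S includes being defined everywhere, so the relation [Sr] is total and can be
   replaced by a map. *)
have /choice[S0 hS0] : forall p, exists m, Sr (p, m) /\ F (m, G p).
  by move=> p; have : (F <o> Sr) (p, G p); [rewrite FS | case=> m /= h1 h2; exists m].
have [S SE] : exists S : {linear H -> H}, S =1 S0.
  apply: mk_linear => a x y; apply: (uSr (a *: x + y)); first by have [] := hS0 (a *: x + y).
  exact: (lSr a _ _ (hS0 x).1 (hS0 y).1).
have hSr p : Sr (p, S p) by rewrite SE; have [] := hS0 p.
have FG p : F (S p, G p) by rewrite SE; have [] := hS0 p.
have symS x y : inner (S x) y = inner x (S y).
  exact: self_adjoint_symmetric saSr _ _ _ _ (hSr x) (hSr y).
have SrE p m : Sr (p, m) -> m = S p by move=> h; exact: (uSr _ _ _ h (hSr p)).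
have hA p : A (S (S p), p - S (S p)).
  have : (Sr <o> Sr) (p, S (S p)) by exists (S p); exact: hSr.
  rewrite eqSr => -[v [w [/= ve Aw pe]]]; have {}ve : v = S (S p) by [].
  by suff -> : p - S (S p) = w by []; rewrite {1}pe ve addrAC subrr add0r.
have hA' x w : A (x, w) -> S (S (x + w)) = x.
  move=> Axw; have : (op_add (graph idfun) A)^-1%relation (x + w, x) by exists x, w.
  by rewrite -eqSr => -[m /= /SrE -> /SrE e]; rewrite -e.
have leSS p : rn (S (S p) : H) <= rn p.
  set u : H := S (S p).
  have [->|un0] := eqVneq u 0; first by rewrite rn0 rn_ge0.
  have un0' : 0 < rn u by rewrite rn_gt0.
  have := posA _ _ (hA p); rewrite -/u ipBl lecE => /andP[_]; rewrite cReD cReN Re_ipxx /= => h.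
  have hc := CauchySchwarz_Re p u; rewrite -(ler_pM2r un0'); nra.
have bS : bounded_map S.
  exists 1 => // p; rewrite mul1r -(ler_pXn2r (n := 2)) ?nnegrE ?rn_ge0 //.
  rewrite -Re_ipxx symS; apply: le_trans (CauchySchwarz_Re _ _) _.
  by rewrite expr2 ler_wpM2l ?rn_ge0.
have injS x : S x = 0 -> x = 0.
  by move=> Sx; have := hA x; rewrite Sx linear0 subr0 => /(uA _ _ _ A0).
have perpS y : (forall x, inner (S x) y = 0) -> y = 0.
  by move=> h; apply: injS; apply: ip_eq0; rewrite -symS h.
have perpS' y : (forall x, range S x -> inner x y = 0) -> y = 0.
  by move=> h; apply: perpS => u; apply: h; exists u.
have denseS x (e : R) : 0 < e -> exists y, rn (x - S y) < e.
  move=> e0; have [|_ [y _ <-] hy] := @subspace_dense _ _ (range S) _ perpS' x e e0.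
  - split=> [|a _ _ [u _ <-] [v _ <-]]; first by exists 0; rewrite ?linear0.
    by exists (a *: u + v); rewrite ?linearP.
  - by exists y.
have domA : linear_subspace (op_dom A).
  by split=> [|a x y [u Au] [v Av]]; [exists 0 | exists (a *: u + v); exact: (lA a _ _ Au Av)].
have domH0 : linear_subspace (op_dom H0).
  by split=> [|a x y [u Au] [v Av]]; [exists 0 | exists (a *: u + v); exact: (l0 a _ _ Au Av)].
have symH0 := self_adjoint_symmetric saH0.
(* P is H0 S^2. The bound comes from |H0| S^2 k = k - S^2 k, of norm at most 2 |k|; taking k in the
   domain of |H0| allows |H0| to be applied a second time. *)
have [P bP hP] : exists2 P : {linear H -> H}, bounded_map P & forall k, H0 (S (S k), P k).
  apply: (@bounded_comp_of_sqr_eq _ _ A H0 (S \o S) (op_dom A) 2 saA saH0 eqA0) => //.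
  - exact: bounded_map_comp.
  - exact/dense_rnP.
  - move=> k [w Aw]; exists (k - S (S k)), (w - (k - S (S k))); split; first exact: hA.
      have := lA (-1) _ _ (hA k) Aw; congr (A (_, _)); by vec.
    by have := rnB k (S (S k)); have := leSS k; lra.
(* Here X is the resolvent of H0 at z and Q is (1 + |H0|) X. Its boundedness is transferred from H0
   X = 1 + z X, with the roles of H0 and |H0| exchanged. *)
have hQ z : complex.Im z != 0 -> exists X Q : {linear H -> H},
    [/\ bounded_map Q, resolvent H0 z = graph X, forall k, H0 (X k, k + z *: X k) &
        forall k, S (S (Q k)) = X k].
  move=> zn0; have [X [bX resX hX]] := self_adjoint_resolvent saH0 zn0.
  have [b b0 hb] := bX.
  have [Q bQ hQ] : exists2 Q : {linear H -> H}, bounded_map Q & forall k, A (X k, Q k).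
    apply: (@bounded_comp_of_sqr_eq _ _ H0 A X (op_dom H0) (1 + rn z * b) saH0 saA) => //.
    - exact/dense_rnP.
    - by have := mulr_ge0 (rn_ge0 z) b0; lra.
    - move=> k [w Hw]; exists (k + z *: X k), (w + z *: (k + z *: X k)); split; first exact: hX.
        have := l0 z _ _ (hX k) Hw; congr (H0 (_, _)); by vec.
      have := rnD k (z *: X k); rewrite rnZ; have := hb k; have := rn_ge0 z.
      move: (rn k) (rn (X k)) (rn z) (rn (k + _)) => k' x' z' t h1 h2 h3; nra.
  exists X, (X \+ Q); split=> //; first exact: bounded_mapD.
  by move=> k /=; exact: hA'.
have SSP x y : inner (S (S (P x))) y = inner x (S (S (P y))).
  by rewrite !symS (symH0 _ _ _ _ (hP x) (hP y)) !symS.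
(* M S = S P defines M as S H0 S. P is its own adjoint for the form <S^2 x, y> because H0 is
   symmetric. *)
have [M bM hM] := conjugation_bounded bS symS denseS bP bP SSP.
have symM x y : inner (M x) y = inner x (M y).
  have [M' bM' hM'] := bounded_adjoint bM.
  rewrite hM'; suff -> : M' y = M y by [].
  have MM' : forall u, M u = M' u.
    apply: (@eq_on_total _ _ _ M M' (range S)) => // _ [u _ <-].
    apply/eqP; rewrite -subr_eq0; apply/eqP/perpS => v.
    by rewrite ipBr -hM' !hM [X in X - _]symS -[X in _ - X]symS SSP subrr.
  exact/esym/MM'.
exists S, G, M; split=> //; first exact: precompact_compact_map.
move=> z zn0.
have [X1 [Q1 [bQ1 resX1 hX1 hQ1]]] := hQ z zn0.
have zn0' : complex.Im (Num.conj z) != 0 by rewrite cImJ oppr_eq0.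
have [X2 [Q2 [bQ2 resX2 hX2 hQ2]]] := hQ _ zn0'.
have Q12 x y : inner (S (S (Q1 x))) y = inner x (S (S (Q2 y))).
  rewrite hQ1 hQ2; have := symH0 _ _ _ _ (hX1 x) (hX2 y); rewrite !ipE conjCK => h.
  by apply: (addIr (z * inner (X1 x) (X2 y))).
(* X S = S Q1 with S^2 Q1 the resolvent. Both inverse identities need checking only on the range of
   S, whose orthogonal complement is zero. *)
have [X bX hX] := conjugation_bounded bS symS denseS bQ1 bQ2 Q12.
exists X; split=> //.
- by rewrite resX1; congr graph; apply/funext => k; rewrite hX hQ1.
- apply: (@eq_on_total _ _ _ (M \o X \- z \*: (S \o (S \o X))) idfun (range S)) => //.
  + apply: bounded_mapB; first exact: bounded_map_comp.
    by apply: bounded_mapZ; do 2!(apply: bounded_map_comp => //).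
  + exact: bounded_map_id.
  + move=> _ [k _ <-] /=; rewrite hX hM hQ1.
    have := hP (Q1 k); rewrite hQ1 => /(u0 _ _ _ (hX1 k)) <-.
    by rewrite linearD linearZ addrK.
- apply: (@eq_on_total _ _ _ (X \o (M \- z \*: (S \o S))) idfun (range S)) => //.
  + apply: bounded_map_comp => //; apply: bounded_mapB => //.
    by apply: bounded_mapZ; apply: bounded_map_comp.
  + exact: bounded_map_id.
  + move=> _ [k _ <-] /=; rewrite hM.
    have -> : S (P k) - z *: S (S (S k)) = S (P k - z *: S (S k)).
      by rewrite [RHS]linearB [X in _ = _ - X]linearZ.
    rewrite hX; congr (S _); set h := P k - _.
    have : graph X1 (h, S (S k)).
      by rewrite -resX1; apply/resolventE; rewrite subrK; exact: hP.
    rewrite graphE -hQ1 => e.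
    have inj u v : S u = S v -> u = v.
      by move=> uv; apply/eqP; rewrite -subr_eq0; apply/eqP/injS; rewrite linearB uv subrr.
    by rewrite -(inj _ _ (inj _ _ e)).
Qed.

End Model.

(** * Perturbed resolvents *)

Section GraphCalculus.
Variable R : realType.
Implicit Types U V W : hilbertType R.

Lemma op_comp_graph U V W (g : V -> W) (f : U -> V) :
  graph g <o> graph f = graph (fun x => g (f x)).
Proof.
apply/seteqP; split=> -[x y]; last by move=> h; exists (f x).
by case=> z /=; rewrite !graphE => ->.
Qed.

Lemma op_add_graph U V (f g : U -> V) : op_add (graph f) (graph g) = graph (f \+ g).
Proof.
apply/seteqP; split=> -[x y]; last by move=> h; exists (f x), (g x).
by case=> v [w [/=]]; rewrite !graphE => -> -> ->.
Qed.

Lemma op_scale_graph U V a (f : U -> V) : op_scale a (graph f) = graph (a \*: f).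
Proof.
apply/seteqP; split=> -[x y]; last by move=> h; exists (f x).
by case=> v /=; rewrite !graphE => -> ->.
Qed.

Lemma inv_graph U V (f : U -> V) (g : V -> U) : cancel f g -> cancel g f ->
  ((graph f)^-1)%relation = graph g.
Proof.
move=> fg gf; apply/seteqP; split=> -[y x] /=; rewrite !graphE => ->.
  by rewrite fg.
by rewrite gf.
Qed.

Lemma adjoint_graph U V (f : U -> V) (g : V -> U) :
  (forall x y, inner (f x) y = inner x (g y)) -> adjoint (graph f) = graph g.
Proof.
move=> fg; apply/seteqP; split=> -[y w].
  move=> h; rewrite graphE; apply: ip_extr => z.
  by rewrite -fg; apply/esym/(h z (f z)).
by rewrite graphE => -> x v; rewrite graphE => -> /=.
Qed.

Definition dense_dom U V (D : set (U * V)) :=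
  forall x (e : R), 0 < e -> exists2 p, D p & rn (x - p.1) < e.

Lemma dense_dom_perp U V (D : set (U * V)) y : dense_dom D ->
  (forall x, op_dom D x -> inner x y = 0) -> y = 0.
Proof.
move=> dD h; apply: rn0_eq; apply/eqP; rewrite eq_le rn_ge0 andbT.
apply/ler_addgt0Pr => e e0; rewrite add0r; have [[x w] Dxw /= hx] := dD y e e0.
have : rn y ^+ 2 <= rn (y - x) * rn y.
  have := CauchySchwarz_Re (y - x) y.
  by rewrite ipBl (h x) ?subr0 ?Re_ipxx //; exists w.
have := rn_ge0 y; have := rn_ge0 (y - x).
by move: (rn y) (rn (y - x)) hx => a b h1 h2 h3 h4; rewrite leNgt; apply/negP; nra.
Qed.

(** Applied to a sandwiched resolvent, this yields the density of the domain of F^*. *)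
Lemma dense_dom_closure U V (D : set (U * V)) (f : U -> V) :
  closure D = graph f -> dense_dom D.
Proof.
move=> cD x e e0; have : closure D (x, f x) by rewrite cD.
by move=> /closure_prodP /(_ e e0)[p [Dp h _]]; exists p.
Qed.

End GraphCalculus.

Section ModelTheory.
Variables (R : realType) (H K : hilbertType R) (H0 : set (H * H)) (F : set (H * K)).
Variables (S : {linear H -> H}) (G : {linear H -> K}) (M : {linear H -> H}).
Variable (G' : {linear K -> H}).
Hypothesis model : rigging_model H0 F S G M.
Hypothesis opF : is_operator F.
Hypothesis bG' : bounded_map G'.
Hypothesis GG' : forall x y, inner (G x) y = inner x (G' y).

Let bS := rm_bS model.
Let symS := rm_symS model.
Let injS := rm_injS model.
Let FG := rm_FG model.
Let symM := rm_symM model.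

Definition resolvent_core (z : R[i]) (X : {linear H -> H}) :=
  [/\ bounded_map X, resolvent H0 z = graph (fun k => S (X (S k))),
    forall p, M (X p) - z *: S (S (X p)) = p &
    forall p, X (M p - z *: S (S p)) = p].

Let bG : bounded_map G. Proof. exact: compact_map_bounded (rm_G model). Qed.

Lemma comp_F_graph (f : H -> H) : F <o> graph (fun k => S (f k)) = graph (fun k => G (f k)).
Proof.
have [_ _ uF] := opF.
apply/seteqP; split=> -[x y]; last first.
  by rewrite graphE => ->; exists (S (f x)) => //=; exact: FG.
by case=> w /=; rewrite graphE => -> /uF; apply; exact: FG.
Qed.

Lemma adjoint_F_dom y h : adjoint F (y, h) -> G' y = S h.
Proof.
by move=> a; apply: ip_extr => p; rewrite -GG' -symS; exact: (a _ _ (FG p)).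
Qed.

(** As F S = G and S F^* is contained in G^*, the operator F S X S F^* is the restriction of the
    bounded G X G^* to the dense domain of F^*. *)
Lemma sandwiched_graph (A : set (H * H)) z (X : {linear H -> H}) : dense_dom (adjoint F) ->
  bounded_map X -> resolvent A z = graph (fun k => S (X (S k))) ->
  sandwiched_resolvent F A z = graph (fun y => G (X (G' y))).
Proof.
move=> dF bX rA; rewrite /sandwiched_resolvent rA (comp_F_graph (fun k => X (S k))).
pose T : {linear K -> K} := G \o (X \o G').
have bT : bounded_map T by apply: bounded_map_comp => //; exact: bounded_map_comp.
apply/seteqP; split=> -[y k].
  move=> /closure_prodP h; apply: (closed_rel_graph bT) => e e0.
  have [[y' k'] [[w /= aw]]] := h e e0; rewrite graphE => -> h1 h2.
  exists (y', G (X (S w))); split=> //.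
  by rewrite graphE /= (adjoint_F_dom aw).
rewrite graphE => ->; apply/closure_prodP => e e0.
have [C C0 hC] := bT; have C1 : 0 < C + 1 by lra.
have r0 : 0 < Num.min e (e / (C + 1)) by rewrite lt_min e0 divr_gt0.
have [[y' w] aw /=] := dF y _ r0; rewrite lt_min => /andP[h1 h2].
exists (y', T y'); split=> //=; last first.
  rewrite ltr_pdivlMr // in h2; have := hC (y - y'); rewrite linearB /= => h3.
  by apply: le_lt_trans h3 _; have := rn_ge0 (y - y'); nra.
by exists w => //; rewrite graphE /T /= (adjoint_F_dom aw).
Qed.

Lemma core_adjoint z X X' : resolvent_core z X -> resolvent_core (Num.conj z) X' ->
  forall p q, inner (X p) q = inner p (X' q).
Proof.
move=> [_ _ h1 _] [_ _ h2 _] p q; rewrite -{1}(h2 q) -{2}(h1 p).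
by rewrite !ipE symM conjCK -!symS.
Qed.

(** The counterpart for X of Im <R_z k, k> = Im z |R_z k|^2; write the second q as (M - z S^2) X
    q. *)
Lemma core_Im z X : resolvent_core z X -> forall q,
  complex.Im (inner (X q) q) = complex.Im z * rn (S (X q) : H) ^+ 2.
Proof.
move=> [_ _ h1 _] q; rewrite -{2}(h1 q) ipBr ipZr -symS ipxx.
have : complex.Im (inner (X q) (M (X q))) = 0.
  by have := ImC (X q) (M (X q)); rewrite symM; lra.
by rewrite cImD cImN cImM cImJ /=; lra.
Qed.

(* T = G X G' has Im T >= 0 or <= 0, with Im <T x, x> = 0 only if T x = 0. *)
Lemma one_plus_sandwich_inverse z X (s : R) : resolvent_core z X -> complex.Im z != 0 -> 0 < s ->
  exists N : {linear K -> K}, [/\ bounded_map N,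
    forall x, N x + (s%:C)%C *: G (X (G' (N x))) = x &
    forall x, N (x + (s%:C)%C *: G (X (G' x))) = x].
Proof.
move=> cX zn0 s0; have [bX _ h1 h2] := cX.
pose T : {linear K -> K} := (s%:C)%C \*: (G \o (X \o G')).
have cT : compact_map T.
  apply: compact_mapZ; apply: compact_map_compr; first exact: rm_G model.
  exact: bounded_map_comp.
have ImT x : complex.Im (inner (x + T x) x) = s * complex.Im z * rn (S (X (G' x)) : H) ^+ 2.
  rewrite ipDl cImD Im_ipxx add0r /T /= ipZl cImM /= mul0r addr0 GG' (core_Im cX).
  by rewrite mulrA.
(* With theta = - i Im z, Re (theta a) = Im z Im a, which covers both half-planes at once. *)
have theta0 : (0 +i* (- complex.Im z))%C != 0 :> R[i].
  by rewrite eq_complex /= negb_and oppr_eq0 zn0 orbT.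
apply: (dissipative_inverse cT theta0).
  move=> x Tx; have := ImT x; rewrite Tx ip0l /= => /esym/eqP.
  rewrite mulf_eq0 sqrf_eq0 mulf_eq0 (negPf zn0) (gt_eqF s0) /= rn_eq0 => /eqP /injS Xx.
  by move: Tx; rewrite /T /= Xx linear0 scaler0 addr0.
move=> x; rewrite cReM /= mul0r sub0r mulNr opprK ImT.
have := sqr_ge0 (complex.Im z); have := sqr_ge0 (rn (S (X (G' x)) : H)).
by move: (rn _ ^+ 2) => a a0 b0; have := mulr_ge0 (mulr_ge0 (ltW s0) b0) a0; nra.
Qed.

End ModelTheory.

(** For a sandwiched resolvent the sign is computed on the domain of F^* and extended by
    continuity. *)
Lemma quadratic_ge0_dense (R : realType) (U : hilbertType R) (D : set U)
    (T : {linear U -> U}) (c : R) :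
  bounded_map T -> (forall x (e : R), 0 < e -> exists2 y, D y & rn (x - y) < e) ->
  (forall x, D x -> 0 <= c * complex.Im (inner (T x) x)) ->
  forall x, 0 <= c * complex.Im (inner (T x) x).
Proof.
move=> [M M0 hM] dD pos x; apply/ler_addgt0Pr => e e0.
pose k := `|c| * (M * (2 * rn x + 1)) + 1.
have x0 := rn_ge0 x; have c0 := normr_ge0 c.
have m0 : 0 <= M * (2 * rn x + 1) by rewrite mulr_ge0 //; lra.
have k0 : 0 < k by rewrite /k; have := mulr_ge0 c0 m0; lra.
have d0 : 0 < Num.min 1 (e / k) by rewrite lt_min ltr01 divr_gt0.
have [y Dy] := dD x _ d0; rewrite lt_min => /andP[h1 h2].
have := pos _ Dy.
have -> : inner (T y) y = inner (T x) x - (inner (T (x - y)) x + inner (T y) (x - y)).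
  by rewrite linearB !ipE; ring.
set q := inner (T x) x; set q1 := inner _ x; set q2 := inner _ (x - y).
have bq : rn (q1 + q2) <= M * (2 * rn x + 1) * rn (x - y).
  have := rnD q1 q2; have := CauchySchwarz_rn (T (x - y)) x; have := CauchySchwarz_rn (T y) (x - y).
  have := hM (x - y); have := hM y; have := rn_leB y x; rewrite rnC => h3 h4 h5 h6 h7 h8.
  have h9 : rn (T y) <= M * (rn x + 1) by apply: le_trans h4 _; rewrite ler_wpM2l //; lra.
  have n0 := rn_ge0 (x - y).
  have h10 : rn (T (x - y)) * rn x <= M * rn (x - y) * rn x by rewrite ler_wpM2r.
  have h11 : rn (T y) * rn (x - y) <= M * (rn x + 1) * rn (x - y) by rewrite ler_wpM2r.
  rewrite -/q1 -/q2 in h6 h7; apply: le_trans h8 _; lra.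
have bI := rnI_ge (q1 + q2).
have bc : `|c * complex.Im (q1 + q2)| <= e.
  rewrite normrM; apply: le_trans (_ : `|c| * (M * (2 * rn x + 1) * rn (x - y)) <= _).
    by rewrite ler_wpM2l //; exact: le_trans bq.
  rewrite ltr_pdivlMr // in h2; apply: le_trans (ltW h2).
  by rewrite mulrA mulrC ler_wpM2l ?rn_ge0 // /k; lra.
by rewrite (cImD q) cImN => h; have := ler_norm (- (c * complex.Im (q1 + q2))); rewrite normrN; lra.
Qed.

Section Perturbation.
Variables (R : realType) (H K : hilbertType R) (H0 : set (H * H)) (F : set (H * K)).
Variables (S : {linear H -> H}) (G : {linear H -> K}) (M : {linear H -> H}).
Variable (G' : {linear K -> H}).
Hypothesis model : rigging_model H0 F S G M.
Hypothesis opF : is_operator F.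
Hypothesis bG' : bounded_map G'.
Hypothesis GG' : forall x y, inner (G x) y = inner x (G' y).
Hypothesis dF : dense_dom (adjoint F).

Let bS := rm_bS model.
Let symS := rm_symS model.
Let injS := rm_injS model.
Let FG := rm_FG model.
Let symM := rm_symM model.
Let bG : bounded_map G. Proof. exact: compact_map_bounded (rm_G model). Qed.
Let core := resolvent_core H0 S M.

Lemma adjoint_F_resolvent z X : core z X -> complex.Im z != 0 ->
  adjoint (F <o> resolvent H0 (Num.conj z)) = graph (fun y => S (X (G' y))).
Proof.
move=> cX zn0; have zn0' : complex.Im (Num.conj z) != 0 by rewrite cImJ oppr_eq0.
have [X' cX'] := rm_res model zn0'; have [_ r _ _] := cX'.
rewrite r (comp_F_graph model opF (fun k => X' (S k))).
by apply: adjoint_graph => x y; rewrite GG' ipC -(core_adjoint model cX cX') -ipC symS.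
Qed.

(* The operator is S^(-1) (M + s G^* G) S^(-1). *)
Lemma form_perturbation_exists (s : R) : 0 < s -> exists A, form_perturbation H0 F idfun s A /\
  forall z X, core z X -> complex.Im z != 0 -> exists T' : {linear K -> K}, [/\ bounded_map T',
    sandwiched_resolvent F A z = graph T' &
    forall y, T' y = G (X (G' (y - (s%:C)%C *: T' y)))].
Proof.
move=> s0; set sC := (s%:C)%C.
pose A : set (H * H) := [set xw | exists p, xw.1 = S p /\ S xw.2 = M p + sC *: G' (G p)].
have injS' x y : S x = S y -> x = y.
  by move=> e; apply/eqP; rewrite -subr_eq0; apply/eqP/injS; rewrite linearB e subrr.
have oA : is_operator A.
  split=> [|a [x w] [x' w'] [p [/= -> hp]] [q [/= -> hq]]
    |x w w' [p [/= -> hp]] [q [/= /injS' pq hq]]].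
  - by exists 0; rewrite /= !linear0 ?scaler0 ?addr0.
  - exists (a *: p + q); rewrite /= !linearP hp hq; split=> //; by vec.
  - by apply: injS'; rewrite hp hq pq.
have symA : symmetric_rel A.
  move=> x w x' w' [p [/= -> hp]] [q [/= -> hq]].
  rewrite -symS hp symS hq !ipE conjR symM -GG'; congr (_ + _ * _).
  by rewrite ipC -GG' -ipC.
(* X' is the inverse of M + s G^* G - z S^2 given by the Woodbury formula, with N = (1 + s
   T_z(H0))^(-1). *)
have coreA z X : core z X -> complex.Im z != 0 -> exists X' N : {linear _ -> _},
    [/\ bounded_map X', forall k, A (S (X' (S k)), k + z *: S (X' (S k))),
    forall k, X' k = X k - sC *: X (G' (N (G (X k)))),
    (forall x, N x + sC *: G (X (G' (N x))) = x) & forall x, N (x + sC *: G (X (G' x))) = x].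
  move=> cX zn0; have [bX r h1 h2] := cX.
  have [N [bN N1 N2]] := one_plus_sandwich_inverse model bG' GG' cX zn0 s0.
  pose X' : {linear H -> H} := X \- sC \*: (X \o (G' \o (N \o (G \o X)))).
  exists X', N; split=> //.
    apply: bounded_mapB => //; apply: bounded_mapZ.
    by do 4![apply: bounded_map_comp => //].
  move=> k; exists (X' (S k)); split=> //=.
  set u := S k; set v := N (G (X u)).
  have e1 : G (X u) = v + sC *: G (X (G' v)) by rewrite N1.
  have e2 : M (X u) = u + z *: S (S (X u)) by rewrite -{2}(h1 u) subrK.
  have e3 : M (X (G' v)) = G' v + z *: S (S (X (G' v))) by rewrite -{2}(h1 (G' v)) subrK.
  rewrite linearD linearZ /= -/u !linearB !linearZ /= -/v e1 e2 e3 linearD linearZ /=.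
  by rewrite [G' (v + _)]linearD [G' (sC *: _)]linearZ /=; vec.
have saA : self_adjoint A.
  have zi : complex.Im ('i : R[i])%C != 0 by exact: oner_neq0.
  have zi' : complex.Im (Num.conj ('i : R[i])%C) != 0 by rewrite cImJ oppr_eq0.
  have [X cX] := rm_res model zi; have [X2 cX2] := rm_res model zi'.
  apply: (symmetric_self_adjoint oA symA zi) => h.
    by have [X' [N [_ hX' _ _ _]]] := coreA _ _ cX zi; exists (S (X' (S h))).
  by have [X' [N [_ hX' _ _ _]]] := coreA _ _ cX2 zi'; exists (S (X' (S h))).
have resA z X' : complex.Im z != 0 -> (forall k, A (S (X' (S k)), k + z *: S (X' (S k)))) ->
    resolvent A z = graph (fun k => S (X' (S k))).
  move=> zn0 hX'; have [Y [_ rY _]] := self_adjoint_resolvent saA zn0.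
  rewrite rY; congr graph; apply/funext => k.
  have : resolvent A z (k, S (X' (S k))) by apply/resolventE.
  by rewrite rY graphE.
exists A; split; first split=> // z zn0.
  have [X cX] := rm_res model zn0; have [bX rX _ _] := cX.
  have [X' [N [bX' hX' X'E N1 N2]]] := coreA _ _ cX zn0.
  rewrite (resA z X' zn0 hX') (adjoint_F_resolvent cX zn0) rX.
  rewrite (comp_F_graph model opF (fun k => X (S k))).
  rewrite (sandwiched_graph model opF bG' GG' dF bX rX) !op_comp_graph op_scale_graph op_add_graph.
  rewrite (inv_graph (g := N)) => [|x|x] /=; [|exact: N2|exact: N1].
  rewrite !op_comp_graph op_scale_graph op_add_graph; congr graph.
  apply/funext => k /=; rewrite X'E linearB linearZ scaleNr.
  by [].
move=> z X cX zn0; have [X' [N [bX' hX' X'E N1 N2]]] := coreA _ _ cX zn0.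
exists (G \o (X' \o G')); split.
- by do 2![apply: bounded_map_comp => //].
- exact: (sandwiched_graph model opF bG' GG' dF bX' (resA z X' zn0 hX')).
(* T' = (1 + s T_z(H0))^(-1) T_z(H0), and T_z(H0) commutes with its own function T', whence T' =
   T_z(H0) (1 - s T'). *)
- move=> y; have T'E : G (X' (G' y)) = N (G (X (G' y))).
    by rewrite X'E linearB linearZ /= -{1}(N1 (G (X (G' y)))) addrK.
  rewrite /= T'E; have := N1 (G (X (G' y))); set v := N _ => e.
  have -> : G (X (G' (y - sC *: v))) = G (X (G' y)) - sC *: G (X (G' v)).
    by rewrite !linearB !linearZ.
  by rewrite -e addrK.
Qed.

(** In [form_perturbation] the inverse of 1 + r T_z(H0) J is a mere relation. The v it relates to F
    R_z(H0) x turns out to be F R_z(A) x, since R_z(A) x is S applied to X S x - r X G^* J v and F S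
    = G. *)
Lemma form_perturbation_sandwich (J : {linear K -> K}) (r : R) (A : set (H * H)) z X
    (Y : {linear H -> H}) :
  form_perturbation H0 F J r A -> core z X -> complex.Im z != 0 -> resolvent A z = graph Y ->
  forall x, exists2 v, F (Y x, v) & v + (r%:C)%C *: G (X (G' (J v))) = G (X (S x)).
Proof.
move=> [_ fp] cX zn0 rY x; have [bX rX _ _] := cX.
have := fp z zn0; rewrite rY (adjoint_F_resolvent cX zn0) rX.
rewrite (comp_F_graph model opF (fun k => X (S k))).
rewrite (sandwiched_graph model opF bG' GG' dF bX rX) !op_comp_graph op_scale_graph op_add_graph.
move=> eY.
have : graph Y (x, Y x) by [].
rewrite eY => -[a [b [ax [c [u xu [v uv vc]] bc] Yab]]]; rewrite !graphE /= in ax xu vc uv bc Yab.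
have {}uv : u = v + (r%:C)%C *: G (X (G' (J v))) := uv.
exists v; last by rewrite -xu uv.
rewrite Yab bc ax vc.
have -> : S (X (S x)) + - (r%:C)%C *: S (X (G' (J v))) = S (X (S x) - (r%:C)%C *: X (G' (J v))).
  by rewrite scaleNr [RHS]linearB [X in _ = _ - X]linearZ.
have ve : v = G (X (S x) - (r%:C)%C *: X (G' (J v))).
  by rewrite linearB linearZ /= -xu uv addrK.
by rewrite [X in F (_, X)]ve; exact: FG.
Qed.

(** The first identity is the adjoint of [form_perturbation_sandwich] at conj z. The second rests on
    Im <T y, y> = Im z |R_z(A) F^* y|^2 for y in the domain of F^*. *)
Lemma sandwich_relation (J : {linear K -> K}) (r : R) (A : set (H * H)) z X
    (T : {linear K -> K}) :
  form_perturbation H0 F J r A -> core z X -> complex.Im z != 0 ->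
  bounded_map J -> (forall x y, inner (J x) y = inner x (J y)) ->
  bounded_map T -> sandwiched_resolvent F A z = graph T ->
  (forall y, T y + (r%:C)%C *: T (J (G (X (G' y)))) = G (X (G' y))) /\
  forall y, 0 <= complex.Im z * complex.Im (inner (T y) y).
Proof.
move=> fp cX zn0 bJ symJ bT sT; have [saA _] := fp.
have symA := self_adjoint_symmetric saA.
have zn0' : complex.Im (Num.conj z) != 0 by rewrite cImJ oppr_eq0.
have [X2 cX2] := rm_res model zn0'; have [bX _ _ _] := cX; have [bX2 _ _ _] := cX2.
have [Y [_ rY hY]] := self_adjoint_resolvent saA zn0.
have [Y2 [_ rY2 hY2]] := self_adjoint_resolvent saA zn0'.
have perpF y : (forall x, op_dom (adjoint F) x -> inner x y = 0) -> y = 0.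
  exact: dense_dom_perp.
have FT y h : adjoint F (y, h) -> F (Y h, T y).
  move=> yh; have [v Fv _] := form_perturbation_sandwich fp cX zn0 rY h.
  have : sandwiched_resolvent F A z (y, v).
    by apply: subset_closure; exists h => //=; exists (Y h) => //; rewrite rY.
  by rewrite sT graphE => <-.
split.
  have [T' bT' TT'] := bounded_adjoint bT.
  (* The adjoint of T is the sandwiched resolvent at conj z; tested against the dense domain of
     F^*. *)
  have T'E y h : adjoint F (y, h) -> F (Y2 h, T' y).
    move=> yh; have [v Fv _] := form_perturbation_sandwich fp cX2 zn0' rY2 h.
    suff -> : T' y = v by [].
    apply/eqP; rewrite -subr_eq0; apply/eqP/perpF => x [k xk].
    have e1 := yh _ _ (FT _ _ xk); have e2 := xk _ _ Fv; rewrite /= in e1 e2.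
    rewrite ipBr -TT' e1 [inner x v]ipC e2 -ipC.
    have := symA _ _ _ _ (hY k) (hY2 h); rewrite !ipE conjCK => e.
    have {}e : inner k (Y2 h) = inner (Y k) h by apply: (addIr (z * inner (Y k) (Y2 h))).
    by rewrite e subrr.
  have T'rel y : T' y + (r%:C)%C *: G (X2 (G' (J (T' y)))) = G (X2 (G' y)).
    pose f : {linear K -> K} := T' \+ (r%:C)%C \*: (G \o (X2 \o (G' \o (J \o T')))).
    pose g : {linear K -> K} := G \o (X2 \o G').
    apply: (@eq_on_total _ _ _ f g (op_dom (adjoint F))) => //.
    - apply: bounded_mapD => //; apply: bounded_mapZ.
      by do 4![apply: bounded_map_comp => //].
    - by do 2![apply: bounded_map_comp => //].
    - move=> {}y [h yh]; have [v Fv] := form_perturbation_sandwich fp cX2 zn0' rY2 h.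
      have [_ _ uF] := opF.
      by rewrite (uF _ _ _ Fv (T'E _ _ yh)) /f /g /= (adjoint_F_dom model GG' yh).
  have T0adj k y : inner (G (X (G' k))) y = inner k (G (X2 (G' y))).
    rewrite GG' (core_adjoint model cX cX2).
    by rewrite ipC -GG' -ipC.
  by move=> y; apply: ip_ext => k; rewrite ipDl ipZl !TT' symJ !T0adj -(T'rel k) ipDr ipZr conjR.
apply: (@quadratic_ge0_dense _ K (op_dom (adjoint F))) => //.
  by move=> x e e0; have [[a b] Fab h] := dF x e0; exists a => //; exists b.
move=> y [h yh]; have := yh _ _ (FT _ _ yh) => /= ->.
have := symA _ _ _ _ (hY h) (hY h); rewrite !ipE ipxx [inner h _]ipC => /(congr1 (@complex.Im R)).
rewrite !(cImD, cImM, cImJ, cReJ) /= => e.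
have -> : complex.Im (inner (Y h) h) = complex.Im z * rn (Y h : H) ^+ 2 by lra.
by rewrite mulrA mulr_ge0 ?sqr_ge0 // -expr2 sqr_ge0.
Qed.

End Perturbation.

(** * The exceptional shifts *)

Section RegularShift.
Variables (R : realType) (K : hilbertType R).
Implicit Types L J : {linear K -> K}.

(* Polarization of the nonnegative form Im <L x, x>, whose null vectors belong
   to its radical. *)
Lemma dissipative_null_hermitian L a b : (forall x, 0 <= complex.Im (inner (L x) x)) ->
  complex.Im (inner (L a) a) = 0 -> complex.Im (inner (L b) b) = 0 ->
  inner (L a) b = Num.conj (inner (L b) a).
Proof.
move=> pos a0 b0.
(* The terms in a alone and in b alone vanish, so the form at a + t b is real-linear in t;
   nonnegativity at 1, -1, i and - i makes it zero. *)
have h (t : R[i]) : 0 <= complex.Im (Num.conj t * inner (L a) b + t * inner (L b) a).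
  have := pos (a + t *: b); rewrite linearD linearZ /= !ipE.
  set q := complex.Im _ => h.
  suff <- : q = complex.Im (Num.conj t * inner (L a) b + t * inner (L b) a) by [].
  rewrite /q !(cImD, cImM, cReD, cReM, cReJ, cImJ) a0 b0; ring.
have := (h 1%C, h (-1)%C, h 'i%C, h (- 'i)%C) => -[[[]]].
rewrite !cImD !cImM !cReJ !cImJ /= => h1 h2 h3 h4.
by apply: complexP; rewrite ?cReJ ?cImJ; lra.
Qed.

(* If every s = 1/(j+1) admitted a unit null vector u, these vectors would be
   orthonormal and lie in the image of a bounded set under the compact L. *)
Lemma exists_injective_shift L J (r : R) : compact_map L ->
  (forall x, 0 <= complex.Im (inner (L x) x)) ->
  bounded_map J -> (forall x y, inner (J x) y = inner x (J y)) ->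
  exists2 s : R, 0 < s &
    forall u, u + L ((s%:C)%C *: u - (r%:C)%C *: J u) = 0 -> u = 0.
Proof.
move=> cL pos [M M0 hM] symJ; apply: contrapT => ns.
pose s (j : nat) : R := j.+1%:R^-1.
have s_gt0 j : 0 < s j by rewrite invr_gt0.
have s_le1 j : s j <= 1 by rewrite invf_le1 // ler1n.
pose W j u := ((s j)%:C)%C *: u - (r%:C)%C *: J u.
have /choice[u hu] : forall j, exists u, rn u = 1 /\ u = - L (W j u).
  move=> j; apply: contrapT => nj; apply: ns; exists (s j) => // v hv.
  apply: contrapT => /eqP v0; apply: nj.
  have v0' : 0 < rn v by rewrite rn_gt0.
  exists (((rn v)^-1%:C)%C *: v); split.
    by rewrite rnZ rn_real ger0_norm ?invr_ge0 ?rn_ge0 // mulVf // gt_eqF.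
  have -> : W j (((rn v)^-1%:C)%C *: v) = ((rn v)^-1%:C)%C *: W j v.
    by rewrite /W [J (_ *: _)]linearZ /=; vec.
  rewrite linearZ -scalerN; congr (_ *: _).
  by apply/eqP; rewrite -addr_eq0 hv.
pose w j := W j (u j).
have uw j : u j = - L (w j) by have [] := hu j.
have Lw0 j : complex.Im (inner (L (w j)) (w j)) = 0.
  have -> : L (w j) = - u j by rewrite [in RHS]uw opprK.
  have := ImC (u j) (J (u j)); rewrite symJ => e.
  have {}e : complex.Im (inner (u j) (J (u j))) = 0 by lra.
  rewrite /w /W !ipE !conjR ipxx !(cImN, cImD, cImM) /= e; lra.
(* With L (w k) = - u k, the hermitian identity reads <u i, w j> = <w i, u j>. The J terms cancel
   and (s j - s i) <u i, u j> = 0 is left. *)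
have orth i j : i != j -> inner (u i) (u j) = 0.
  move=> ij; have := dissipative_null_hermitian pos (Lw0 i) (Lw0 j).
  have Lw k : L (w k) = - u k by rewrite [in RHS]uw opprK.
  rewrite !Lw !ipNl rmorphN /= -ipC /w /W !ipE !conjR symJ => e.
  have {e} : (((s j)%:C)%C - ((s i)%:C)%C) * inner (u i) (u j) = 0.
    apply/eqP; rewrite mulrBl subr_eq0; apply/eqP.
    by move/oppr_inj: e => /addIr.
  move=> /eqP; rewrite mulf_eq0 subr_eq0 => /orP[/eqP/complexI/invr_inj/eqP|/eqP //].
  by rewrite eqr_nat eqSS eq_sym (negPf ij).
pose C := 1 + `|r| * M.
have C0 : 0 < C by rewrite /C; have := mulr_ge0 (normr_ge0 r) M0; lra.
have bw j : rn (w j) <= C.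
  rewrite /w /W; apply: le_trans (rnB _ _) _; rewrite !rnZ !rn_real (hu j).1 mulr1.
  rewrite (ger0_norm (ltW (s_gt0 j))) /C lerD // ler_wpM2l //.
  by have := hM (u j); rewrite (hu j).1 mulr1.
(* The vectors w j / C lie in the unit ball, so a net of mesh 1 / (2 C) approximates u j = - L (w j)
   within 1/2 after rescaling. Two u j sharing a net point would be at distance at most 1, but
   orthonormal vectors are at distance sqrt 2. *)
have [ys hys] := cL (1 / (2 * C)) (ltac:(by rewrite divr_gt0 // mulr_gt0)).
have /choice[y hy] : forall j, exists y, y \in ys /\ rn (u j + (C%:C)%C *: y) <= 1 / 2.
  move=> j; have [|y yys h] := hys ((C^-1%:C)%C *: w j).
    by rewrite rnZ rn_real ger0_norm ?invr_ge0 ?(ltW C0) // mulrC ler_pdivrMr // mul1r.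
  exists y; split=> //.
  have -> : u j + (C%:C)%C *: y = - ((C%:C)%C *: (L ((C^-1%:C)%C *: w j) - y)).
    rewrite [L (_ *: _)]linearZ /= scalerBr scalerA -rmorphM mulfV ?gt_eqF //= scale1r {1}uw.
    by rewrite opprB addrC.
  rewrite rnN rnZ rn_real (ger0_norm (ltW C0)); apply: le_trans (ler_wpM2l (ltW C0) h) _.
  have -> : C * (1 / (2 * C)) = 1 / 2 by field; rewrite gt_eqF.
  by [].
have yinj : injective y.
  move=> i j yij; apply/eqP/negPn/negP => ij.
  have := rn_sqrB (u i) (u j); rewrite (orth _ _ ij) !(hu _).1 /= => e.
  have : rn (u i - u j) <= 1.
    have := rnB (u i + (C%:C)%C *: y i) (u j + (C%:C)%C *: y j).
    have -> : u i + (C%:C)%C *: y i - (u j + (C%:C)%C *: y j) = u i - u j by rewrite yij; vec.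
    by have := (hy i).2; have := (hy j).2; lra.
  by have := rn_ge0 (u i - u j); nra.
have : (size [seq y i | i <- iota 0 (size ys).+1] <= size ys)%N.
  apply: uniq_leq_size; first by rewrite map_inj_uniq // iota_uniq.
  by move=> _ /mapP[j _ ->]; have [] := hy j.
by rewrite size_map size_iota ltnn.
Qed.

End RegularShift.

(** * Existence of the boundary value for a positive multiple of F^* F *)

Theorem theorem1p1 (R : realType) (H K : hilbertType R)
    (H0 : set (H * H)) (F : set (H * K)) (lambda : R) :
  self_adjoint H0 -> rigging H0 F ->
  semi_regular H0 F lambda ->
  (* F^* F is the perturbation F^* J F with J the identity *)
  regular_direction H0 F lambda idfun.
Proof.
move=> saH0 rig [J [cJ symJ] [r [A [fpA [L cL limA]]]]].
have [opF _ _] := rig.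
have [S [G [M model]]] := rigging_modelP saH0 rig.
have cG := rm_G model; have bG := compact_map_bounded cG.
have [G' bG' GG'] := bounded_adjoint bG.
have bJ : bounded_map J by apply/continuous_boundedP.
have bL : bounded_map L by apply/continuous_boundedP.
pose Z (y : R) := (lambda +i* y)%C.
have lim (e : R) : 0 < e -> \forall y \near 0^'+, 0 < y /\
    exists T : {linear K -> K}, [/\ bounded_map T,
      sandwiched_resolvent F A (Z y) = graph T & forall x, rn (T x - L x) <= e * rn x].
  move=> e0; have := limA e e0; apply: filter_app; have := nbhs_right_gt (0 : R).
  apply: filterS => y y0 [T [cT sT hT]]; split=> //.
  exists T; split=> //; first by apply/continuous_boundedP.
  by move=> x; have := hT x; rewrite !rnE -rmorphM lecR.
have dF : dense_dom (adjoint F).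
  have [y [y0 [T [_ sT _]]]] := filter_ex (lim 1 ltr01).
  move=> x e e0; have [[k w] [h yh _] hk] := dense_dom_closure sT x e0.
  by exists (k, h).
have at_z y : 0 < y -> exists X, resolvent_core H0 S M (Z y) X.
  by move=> y0; apply: (rm_res model); rewrite /= gt_eqF.
have rel y X (T : {linear K -> K}) : 0 < y -> resolvent_core H0 S M (Z y) X ->
    bounded_map T -> sandwiched_resolvent F A (Z y) = graph T ->
    (forall k, T k + (r%:C)%C *: T (J (G (X (G' k)))) = G (X (G' k))) /\
    forall k, 0 <= complex.Im (inner (T k) k).
  move=> y0 cX bT sT; have zn0 : complex.Im (Z y) != 0 by rewrite /= gt_eqF.
  have [h1 h2] := sandwich_relation model opF bG' GG' dF fpA cX zn0 bJ symJ bT sT.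
  by split=> // k; have := h2 k; rewrite /= pmulr_rge0.
have compL : compact_map L.
  apply: compact_map_limit => e e0; have [y [y0 [T [bT sT hT]]]] := filter_ex (lim e e0).
  exists T => //; have [X cX] := at_z y y0; have [h _] := rel _ _ _ y0 cX bT sT.
  have [bX _ _ _] := cX.
  (* Solving the resolvent relation for T exhibits the compact factor G; the norm limit L inherits
     compactness. *)
  have -> : (T : K -> K) = (idfun \- (r%:C)%C \*: (T \o J)) \o (G \o (X \o G')).
    by apply/funext => k /=; rewrite -{1}h addrK.
  apply: compact_map_compl; last by apply: compact_map_compr => //; exact: bounded_map_comp.
  apply: bounded_mapB; first exact: bounded_map_id.
  by apply: bounded_mapZ; exact: bounded_map_comp.
have posL k : 0 <= complex.Im (inner (L k) k).
  apply/ler_addgt0Pr => e e0.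
  have p0 : 0 < rn k ^+ 2 + 1 by have := sqr_ge0 (rn k); lra.
  have [y [y0 [T [bT sT hT]]]] := filter_ex (lim _ (divr_gt0 e0 p0)).
  have [X cX] := at_z y y0; have [_ /(_ k) h] := rel _ _ _ y0 cX bT sT.
  have -> : inner (L k) k = inner (T k) k - inner (T k - L k) k by rewrite ipBl; ring.
  rewrite cImD cImN; have := rnI_ge (inner (T k - L k) k).
  have := CauchySchwarz_rn (T k - L k) k; have := hT k.
  set d := e / _; have de : d * (rn k ^+ 2 + 1) = e by rewrite divfK // gt_eqF.
  have := ler_norm (complex.Im (inner (T k - L k) k)).
  have := rn_ge0 k; have d0 : 0 < d by exact: divr_gt0.
  move: (rn (T k - L k)) (rn k) (rn (inner _ _)) de => a b c de b0 h1 h2 h3 h4.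
  have : a * b <= d * b * b by rewrite ler_wpM2r.
  by lra.
have [s s0 injs] := exists_injective_shift r compL posL bJ symJ.
pose W : {linear K -> K} := (s%:C)%C \*: idfun \- (r%:C)%C \*: J.
have bW : bounded_map W.
  apply: bounded_mapB; apply: bounded_mapZ => //; exact: bounded_map_id.
have [c c0 hc] := compact_bounded_below (compact_map_compr compL bW) injs.
have [A' [fpA' hA']] := form_perturbation_exists model opF bG' GG' dF s0.
have [w w0 hw] := bW; have [l l0 hl] := bL.
(* Substitute k - s T' k in the relation for T: T_z(H0) sends this vector to T' k, so T_z(H0) is
   eliminated. *)
have T'rel y X (T T' : {linear K -> K}) : 0 < y -> resolvent_core H0 S M (Z y) X ->
    bounded_map T -> sandwiched_resolvent F A (Z y) = graph T ->
    (forall k, T' k = G (X (G' (k - (s%:C)%C *: T' k)))) ->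
    forall k, T' k + T (W (T' k)) = T k.
  move=> y0 cX bT sT eT' k; have [h _] := rel _ _ _ y0 cX bT sT.
  have := h (k - (s%:C)%C *: T' k); rewrite -eT' linearB linearZ /= => e.
  rewrite -[in RHS](addrK ((r%:C)%C *: T (J (T' k)) - (s%:C)%C *: T (T' k)) (T k)).
  rewrite /W /= linearB !linearZ /=; rewrite -{1}e; vec.
have get_T' y X : 0 < y -> resolvent_core H0 S M (Z y) X -> exists T' : {linear K -> K},
    [/\ bounded_map T', sandwiched_resolvent F A' (Z y) = graph T' &
    forall k, T' k = G (X (G' (k - (s%:C)%C *: T' k)))].
  by move=> y0 cX; apply: hA' => //; rewrite /= gt_eqF.
clearbody W.
pose D0 : {linear K -> K} := idfun \+ (L \o W).
have bD0 : bounded_map D0 by apply: bounded_mapD; [exact: bounded_map_id | exact: bounded_map_comp].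
(* 1 + L W is bounded below by c. Its surjectivity comes from 1 + T W, for which 1 - T' W is a right
   inverse; T is taken close enough to L for (T - L) W to have norm at most c / 4. *)
have [N [bN D0N _]] : exists N : {linear K -> K},
    [/\ bounded_map N, forall x, D0 (N x) = x & forall x, N (D0 x) = x].
  have d0 : 0 < c / 4 / (w + 1) by rewrite divr_gt0 ?divr_gt0 //; lra.
  have [y [y0 [T [bT sT hT]]]] := filter_ex (lim _ d0).
  have [X cX] := at_z y y0; have [T' [bT' _ eT']] := get_T' y X y0 cX.
  have h := T'rel _ _ _ _ y0 cX bT sT eT'.
  apply: (@inverse_of_approx _ _ (idfun \+ (T \o W)) D0 c bD0 c0 hc) => [k|k].
    exists (k - T' (W k)); rewrite /= !linearB /= -{1}(h (W k)).
    by vec.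
  rewrite /D0 /= opprD addrACA subrr add0r; apply: le_trans (hT _) _.
  have := hw k; set d := c / 4 / _.
  have de : d * (w + 1) = c / 4 by rewrite divfK // gt_eqF //; lra.
  have := rn_ge0 k; rewrite -/d in d0; rewrite -de.
  move: (rn k) (rn (W k)) => a b a0 hb.
  have : d * b <= d * (w * a) by rewrite ler_wpM2l // ltW.
  by nra.
pose L' : {linear K -> K} := N \o L.
have bL' : bounded_map L' by exact: bounded_map_comp.
have [l' l'0 hl'] := bL'.
exists s, A'; split=> //; exists L'; first exact/continuous_boundedP.
move=> e e0.
have k1 : 0 < w + 1 by lra.
have wl : 0 <= w * l' by rewrite mulr_ge0.
have k2 : 0 < 1 + w * l' by lra.
(* With q = |T' k - L' k|, the estimate is c q <= d w q + d (1 + w l') |k|. The first bound on d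
   absorbs d w q into half of the left side, the second makes the rest at most e c / 2 |k|. *)
pose d := Num.min (c / 2 / (w + 1)) (e * c / 2 / (1 + w * l')).
have d0 : 0 < d by rewrite lt_min !divr_gt0 // mulr_gt0.
have := lim _ d0; apply: filterS => y [y0 [T [bT sT hT]]].
have [X cX] := at_z y y0; have [T' [bT' sT' eT']] := get_T' y X y0 cX.
have h := T'rel _ _ _ _ y0 cX bT sT eT'.
exists T'; split=> //; first exact/continuous_boundedP.
move=> k; rewrite !rnE -rmorphM lecR.
have h1 : rn (D0 (T' k - L' k)) <= d * rn k + d * (w * rn (T' k)).
  (* Difference of (1 + T W) T' = T and (1 + L W) L' = L. The norm of T' on the right is bounded
     through L', so no prior uniform bound on T' is required. *)
  have -> : D0 (T' k - L' k) = (T k - L k) - (T (W (T' k)) - L (W (T' k))).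
    by rewrite linearB [D0 (L' k)](D0N (L k)) -(h k) /D0 /=; vec.
  apply: le_trans (rnB _ _) _; apply: lerD => //.
  by apply: le_trans (hT _) _; rewrite ler_wpM2l // ltW.
have h2 : c * rn (T' k - L' k) <= rn (D0 (T' k - L' k)) by exact: hc.
have h3 : rn (T' k) <= rn (T' k - L' k) + l' * rn k.
  by apply: le_trans (rn_leB _ (L' k)) _; rewrite lerD2l.
have d1 : d * (w + 1) <= c / 2 by rewrite -ler_pdivlMr // ge_min lexx.
have d2 : d * (1 + w * l') <= e * c / 2 by rewrite -ler_pdivlMr // ge_min lexx orbT.
move: (rn_ge0 (T' k - L' k)) (rn_ge0 k) h1 h2 h3.
move: (rn (D0 _)) (rn (T' k - L' k)) (rn (T' k)) (rn k) => p q t a q0 a0 h1 h2 h3.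
have h4 : d * (w * t) <= d * (w * (q + l' * a)) by rewrite ler_wpM2l ?(ltW d0) // ler_wpM2l.
have h5 : d * w * q <= c / 2 * q by rewrite ler_wpM2r //; lra.
have h6 : d * (1 + w * l') * a <= e * c / 2 * a by rewrite ler_wpM2r.
have : c / 2 * q <= c / 2 * (e * a) by lra.
by rewrite ler_pM2l // divr_gt0.
Qed.
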